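(* Let $W\subset GL(V)$ be a finite complex reflection group, $k=\{k_{H,i}\}$ a $W$-invariant collection of non-negative integers with $k_{H,0}=0$, $Q_k$ the space of $k$-quasi-invariants, and $U_k=eH_ke$ the spherical subalgebra of the rational Cherednik algebra $H_k$. The image of the Dunkl representation $\mathrm{Res}:U_k\hookrightarrow\mathcal{D}(V_{\mathrm{reg}})^W$ coincides with $\mathcal{D}(Q_k)^W$. Thus the Dunkl representation of $U_k$ yields an algebra isomorphism $U_k\cong\mathcal{D}(Q_k)^W$.
   Context: Let $V$ be a finite-dimensional complex vector space and $W\subset GL(V)$ a finite group generated by complex reflections (elements acting as the identity on some hyperplane). $\mathcal{A}$ is the set of reflection hyperplanes of $W$; for $H\in\mathcal{A}$, $W_H$ is the pointwise stabilizer of $H$ in $W$, a cyclic group of order $n_H\ge 2$, and $\alpha_H\in V^*$ is a linear form with kernel $H$. $W$ acts on functions by $(wf)(x)=f(w^{-1}x)$. With $\det$ the determinant character of $W$ on $V$, put $e_{H,i}=\frac{1}{n_H}\sum_{w\in W_H}(\det w)^{-i}\,w\in\mathbb{C}W$, $i$ taken modulo $n_H$. $W$-invariance of $k$ means $k_{H,i}=k_{H',i}$ if $H,H'$ are in the same $W$-orbit. $Q_k$ is the space of all $f\in\mathbb{C}[V]$ with $e_{H,-i}(f)\equiv 0 \bmod \langle\alpha_H\rangle^{n_Hk_{H,i}}$ for all $H\in\mathcal{A}$, $i=0,\dots,n_H-1$. $A_k=\{p\in\mathbb{C}[V]:pQ_k\subseteq Q_k\}$, and $\mathcal{D}(Q_k)$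 is the ring of differential operators on the $A_k$-module $Q_k$, identified with $\{D\in\mathcal{D}(\mathbb{C}(V)): D(Q_k)\subseteq Q_k\}$, where $\mathcal{D}(\mathbb{C}(V))$ is the ring of differential operators on the field $\mathbb{C}(V)$. Under this identification $\mathcal{D}(Q_k)\subseteq\mathcal{D}(V_{\mathrm{reg}})$, and $W$ acts on $\mathcal{D}(Q_k)$ by conjugation since $Q_k$ is $W$-stable. $V_{\mathrm{reg}}=V\setminus\bigcup_{H\in\mathcal{A}}H$, and $\mathcal{D}W=\mathcal{D}(V_{\mathrm{reg}})*W$ (crossed product). The Dunkl operators are $T_\xi=\partial_\xi-\sum_{H\in\mathcal{A}}\frac{\alpha_H(\xi)}{\alpha_H}\sum_{i=0}^{n_H-1}n_Hk_{H,i}e_{H,i}\in\mathcal{D}W$, $\xi\in V$. $H_k$ is the subalgebra of $\mathcal{D}W$ generated by $\mathbb{C}[V]$, $\mathbb{C}W$ and all $T_\xi$; $e=|W|^{-1}\sum_{w\in W}w$ and $U_k=eH_ke$. The map $\mathrm{Res}:U_k\hookrightarrow\mathcal{D}(V_{\mathrm{reg}})^W$ is the composite of the inclusion $U_k\subset e\,\mathcal{D}W\,e$ with the inverse of the isomorphism $\mathcal{D}(V_{\mathrm{reg}})^W\to e\,\mathcal{D}W\,e$, $D\mapsto eDe=eD=De$. *)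

(* Defs.v *)
From HB Require Import structures.
From mathcomp Require Import all_boot all_order all_algebra all_fingroup.
From mathcomp Require Import mxrepresentation.
From mathcomp Require Import boolp classical_sets functions.
From mathcomp Require Import mpoly.

Set Implicit Arguments.
Unset Strict Implicit.
Unset Printing Implicit Defensive.

Import GRing.Theory.

Local Open Scope classical_set_scope.
Local Open Scope ring_scope.

Notation "x %:F" := (@FracField.tofrac _ x) : ring_scope.

(* The vector space is V = C^n (column vectors), and the finite subgroup W of
   GL(V) is given by a finite group W with a faithful representation rW, w
   acting by v |-> rW w *m v.  C[V] is {mpoly C[n]} and C(V) its fraction
   field.  Operators on C(V) are plain functions; they are multiplied by
   composition, and only their additive structure is taken pointwise. *)

Section Reflections.

Variables (C : fieldType) (n : nat) (W : finGroupType).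
Variable rW : mx_representation C [set: W]%G n.

Definition lact (w : W) : 'End('cV[C]_n) := linfun (mulmx (rW w)).

(* The fixed space is a hyperplane; this excludes the identity. *)
Definition is_reflection (w : W) : bool := (\dim (fixedSpace (lact w))).+1 == n.

Definition hyperplanes : seq {vspace 'cV[C]_n} :=
  undup [seq fixedSpace (lact w) | w <- enum W & is_reflection w].

Definition hstab (H : {vspace 'cV[C]_n}) : {set W} :=
  [set w | (H <= fixedSpace (lact w))%VS]%SET.

Definition hord (H : {vspace 'cV[C]_n}) : nat := #|hstab H|.

End Reflections.

Section FunctionField.

Variables (C : fieldType) (n : nat).
Local Notation CV := {mpoly C[n]}.
Local Notation KV := {fraction CV}.

Definition constK (c : C) : KV := (c%:MP : CV)%:F.

Definition linform (a : 'Hom('cV[C]_n, C^o)) : CV :=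
  \sum_(j < n) a (delta_mx j ord0) *: 'X_j.

Definition dirderiv (xi : 'cV[C]_n) (p : CV) : CV :=
  \sum_(j < n) xi j ord0 *: p^`M(j).

(* dirderivK and ratact extend dirderiv and polact to C(V) by the quotient
   rule and by w(p/q) = w(p)/w(q); the result does not depend on the
   representative p/q. *)
Definition dirderivK (xi : 'cV[C]_n) (x : KV) : KV :=
  let p := \n_(generic_quotient.repr x) in let q := \d_(generic_quotient.repr x) in
  (dirderiv xi p * q - p * dirderiv xi q)%:F / (q ^+ 2)%:F.

Variables (W : finGroupType) (rW : mx_representation C [set: W]%G n).

(* (w f)(x) = f(w^-1 x) *)
Definition polact (w : W) (f : CV) : CV :=
  f \mPo [tuple \sum_(j < n) rW (w^-1)%g i j *: 'X_j | i < n].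

Definition ratact (w : W) (x : KV) : KV :=
  (polact w \n_(generic_quotient.repr x))%:F / (polact w \d_(generic_quotient.repr x))%:F.

(* The group algebra element \sum_w c(w) w is represented by c : W -> C. *)
Definition gact (c : W -> C) (f : CV) : CV := \sum_(w : W) c w *: polact w f.

(* e_{H,i}; since det(w)^(n_H) = 1 for w in W_H, it depends on i only
   modulo n_H. *)
Definition idem_H (H : {vspace 'cV[C]_n}) (i : int) (w : W) : C :=
  if w \in hstab rW H then (hord rW H)%:R^-1 * \det (rW w) ^ (- i) else 0.

Definition idem_W (w : W) : C := #|W|%:R^-1.

Definition mulop (f : KV) : KV -> KV := fun x => f * x.

(* diffop_lt m D : D has order < m in Grothendieck's sense, i.e. all
   (m-fold) iterated commutators with multiplications vanish. *)
Fixpoint diffop_lt (m : nat) (D : KV -> KV) : Prop :=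
  if m is m'.+1 then forall a : KV, diffop_lt m' (fun x => D (a * x) - a * D x)
  else forall x, D x = 0.

Definition Clinear (D : KV -> KV) : Prop :=
  forall (c : C) (x y : KV), D (constK c * x + y) = constK c * D x + D y.

Definition diffops : set (KV -> KV) :=
  [set D | Clinear D /\ exists m, diffop_lt m D].

(* Applied to Q_k this is the ring of differential operators on the
   A_k-module Q_k, and applied to C[Vreg] the ring D(Vreg), both realized
   inside the differential operators on the field C(V). *)
Definition diffops_on (M : set KV) : set (KV -> KV) :=
  [set D | diffops D /\ forall x, M x -> M (D x)].

Definition conjop (w : W) (D : KV -> KV) : KV -> KV :=
  ratact w \o D \o ratact (w^-1)%g.

Definition invops (S : set (KV -> KV)) : set (KV -> KV) :=
  [set D | S D /\ forall w : W, conjop w D = D].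

(* Elements \sum_w a(w) w of the crossed product of an algebra of operators
   with W, represented by a : W -> (KV -> KV), with w D = (w D w^-1) w. *)
Local Notation crossed := (W -> KV -> KV).

Definition cmul (a b : crossed) : crossed :=
  fun w => \sum_(u : W) (a u \o conjop u (b (u^-1 * w)%g)).

Definition cscale (c : C) (a : crossed) : crossed :=
  fun w x => constK c * a w x.

Definition cop (D : KV -> KV) : crossed :=
  fun w => if w == 1%g then D else 0.

Definition cgrp (c : W -> C) : crossed := fun w => mulop (constK (c w)).

Definition subalgebra (S : set crossed) : Prop :=
  [/\ S (cop id),
      forall a b, S a -> S b -> S (a + b),
      forall c a, S a -> S (cscale c a)
    & forall a b, S a -> S b -> S (cmul a b)].

Definition subalgebra_gen (G : set crossed) : set crossed :=
  [set a | forall S : set crossed, subalgebra S -> G `<=` S -> S a].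

(* isomorphism of algebras from B, with product cmul and unit e, to a
   subalgebra B' of the operators on KV *)
Definition algebra_iso (e : crossed) (B : set crossed) (B' : set (KV -> KV))
    (f : crossed -> KV -> KV) : Prop :=
  [/\ set_bij B B' f,
      f e = id,
      forall a b, B a -> B b -> f (a + b) = f a + f b,
      forall c a, B a -> f (cscale c a) = (fun x => constK c * f a x)
    & forall a b, B a -> B b -> f (cmul a b) = f a \o f b].

Section Cherednik.

Variable alpha : {vspace 'cV[C]_n} -> 'Hom('cV[C]_n, C^o).
Variable k : {vspace 'cV[C]_n} -> nat -> nat.

(* C[Vreg] is the localization of C[V] at the product of the alpha_H. *)
Definition Vreg_functions : set KV :=
  [set x | exists (p : CV) (m : nat),
     x = p%:F / ((\prod_(H <- hyperplanes rW) linform (alpha H)) ^+ m)%:F].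

Definition DVreg : set (KV -> KV) := diffops_on Vreg_functions.

Definition quasi_invariant : set CV :=
  [set f | forall H, H \in hyperplanes rW -> forall i, (i < hord rW H)%N ->
     exists g : CV,
       gact (idem_H H (- i%:Z)) f = g * linform (alpha H) ^+ (hord rW H * k H i)].

Definition DQ : set (KV -> KV) :=
  diffops_on [set f%:F | f in quasi_invariant].

Definition dunkl (xi : 'cV[C]_n) : crossed :=
  cop (dirderivK xi)
  - \sum_(H <- hyperplanes rW)
      cmul (cop (mulop (constK (alpha H xi) / (linform (alpha H))%:F)))
           (cgrp (fun w => \sum_(i < hord rW H)
                     (hord rW H * k H i)%:R * idem_H H i w)).

Definition cherednik : set crossed :=
  subalgebra_gen (range (fun p : CV => cop (mulop p%:F))
             `|` range cgrp `|` range dunkl).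

Definition spherical : set crossed :=
  [set cmul (cgrp idem_W) (cmul h (cgrp idem_W)) | h in cherednik].

(* The inverse of D |-> e D e, from e (D(Vreg) * W) e to D(Vreg)^W; the
   default value id is irrelevant. *)
Definition Res (u : crossed) : KV -> KV :=
  xget (id : KV -> KV) [set D | invops DVreg D
                 /\ cmul (cgrp idem_W) (cmul (cop D) (cgrp idem_W)) = u].

End Cherednik.

End FunctionField.

(* Main.v *)
(* Elements of C[V] (x) CW, with W acting diagonally, carry the e_{H,i} through
   the second factor as well.  Those F for which (1 (x) e_{H,i}) F is divisible
   by alpha_H^(n_H k_{H,i}) form an H_k-module: the Dunkl operators preserve it
   by a computation along each hyperplane separately.  Its W-invariants are
   Q_k, so Res maps e H_k e into D(Q_k)^W.

   Conversely let D in D(Q_k)^W have order m and symbol sigma.  For delta the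
   product of the alpha_H and a fixed large N one has
   delta^N C[V] <= Q_k <= C[V], so D^r delta^N maps C[V] to itself for every r
   and sigma^r delta^N is polynomial for every r; as the alpha_H are prime
   elements, sigma itself is polynomial.  Substituting Dunkl operators for the
   derivatives in sigma gives h in H_k such that Res (e h e) has the same
   symbol as D, and one concludes by induction on the order. *)
Require Import Defs.
From HB Require Import structures.
From mathcomp Require Import all_boot all_order all_algebra all_fingroup.
From mathcomp Require Import mxrepresentation cyclic complex.
From mathcomp Require Import boolp classical_sets functions reals.
From mathcomp Require Import mpoly.
From mathcomp Require ssrcomplements.
From mathcomp Require Import ring zify.

Set Implicit Arguments.
Unset Strict Implicit.
Unset Printing Implicit Defensive.

Import Order.TTheory GRing.Theory Num.Theory.

Local Open Scope classical_set_scope.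
Local Open Scope ring_scope.

(** A single Dunkl operator need not preserve Q_k; only e H_k e does. Hence the detour through C[V]
    (x) CW, where the conditions sit in a factor untouched by differentiation. Moving 1 (x) e_{H,j}
    past the diagonal e_{H,i} leaves e_{H,i-j} on polynomials. For i <> j its image vanishes on H,
    as W_H acts there by a nontrivial character; for i = j it is the identity modulo alpha_H.
    Differentiating alpha_H^(n_H k_{H,j}) produces the factor n_H k_{H,j} that the term i = j
    cancels on H, which explains the exponent. In the converse direction an operator is a polynomial
    in commuting symbols with coefficients in C(V): commutation with a coordinate is formal
    differentiation, and composition is the product up to lower degree. One application of D only
    bounds the poles of sigma by delta^N. Since D preserves Q_k, the same N serves all powers of D,
    while a pole of order v would grow to order r v. The two sides meet through w e = e: one has e h
    e = D e, where D is the mean of the conjugates of the sum of the coefficients of h. *)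

Section FractionField.

(** * Fractions and their representatives *)

Variable R : idomainType.
Implicit Types (p q : R) (x : {fraction R}).

Lemma fraction_repr x :
  x = (\n_(generic_quotient.repr x))%:F / (\d_(generic_quotient.repr x))%:F.
Proof.
have d0 := denom_ratioP (generic_quotient.repr x).
apply: (@mulIf _ (\d_(generic_quotient.repr x))%:F); first by rewrite tofrac_eq0.
rewrite divfK ?tofrac_eq0 //.
rewrite -{1}[x]generic_quotient.reprK.
move: (generic_quotient.repr x) d0 => r d0.
rewrite !generic_quotient.piE; apply/generic_quotient.eqmodP => /=.
rewrite FracField.equivfE /FracField.mulf !numden_Ratio ?mulf_neq0 ?oner_eq0 //.
by rewrite !mulr1 mulrC.
Qed.

Lemma fractionP x : exists p q, q != 0 /\ x = p%:F / q%:F.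
Proof.
exists (\n_(generic_quotient.repr x)), (\d_(generic_quotient.repr x)).
by split; [exact: denom_ratioP | exact: fraction_repr].
Qed.

Lemma fraction_eq p q p' q' : q != 0 -> q' != 0 ->
  (p%:F / q%:F == p'%:F / q'%:F) = (p * q' == p' * q).
Proof.
by move=> q0 q'0; rewrite eqr_div ?tofrac_eq0 // -!tofracM tofrac_eq.
Qed.

(** A fraction determines its chosen representative only up to cross multiplication; this relation
    makes both [dirderivK] and [ratact] independent of the representative. *)
Lemma fraction_cross p q : q != 0 ->
  p * \d_(generic_quotient.repr (p%:F / q%:F)) =
  \n_(generic_quotient.repr (p%:F / q%:F)) * q.
Proof.
move=> q0; apply/eqP; rewrite -fraction_eq ?denom_ratioP //.
by rewrite -fraction_repr.
Qed.

End FractionField.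

(** * Directional derivatives and the group action on C(V) *)

Section FunctionFieldOperators.

Variables (C : fieldType) (n : nat).
Local Notation CV := {mpoly C[n]}.
Local Notation KV := {fraction CV}.

Lemma constKB : zmod_morphism (@constK C n).
Proof. by move=> a b; rewrite /constK mpolyCB tofracB. Qed.

HB.instance Definition _ :=
  GRing.isZmodMorphism.Build C KV (@constK C n) constKB.

Lemma constK_monoid : monoid_morphism (@constK C n).
Proof. by split=> [|a b]; rewrite /constK ?mpolyC1 ?tofrac1 // mpolyCM tofracM. Qed.

HB.instance Definition _ :=
  GRing.isMonoidMorphism.Build C KV (@constK C n) constK_monoid.

Lemma dirderivB xi : zmod_morphism (@dirderiv C n xi).
Proof.
move=> p q; rewrite /dirderiv -sumrB; apply: eq_bigr => i _.
by rewrite mderivB scalerBr.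
Qed.

HB.instance Definition _ xi :=
  GRing.isZmodMorphism.Build CV CV (dirderiv xi) (@dirderivB xi).

Lemma dirderivM xi (p q : CV) :
  dirderiv xi (p * q) = dirderiv xi p * q + p * dirderiv xi q.
Proof.
rewrite /dirderiv mulr_suml mulr_sumr -big_split; apply: eq_bigr => i _ /=.
by rewrite mderivM scalerDr scalerAl scalerAr.
Qed.

Lemma dirderivC xi (c : C) : dirderiv xi (c%:MP : CV) = 0.
Proof. by rewrite /dirderiv big1 // => i _; rewrite mderivC scaler0. Qed.

Lemma dirderivX xi i : dirderiv xi ('X_i : CV) = (xi i ord0)%:MP.
Proof.
rewrite /dirderiv (bigD1 i) //= big1 ?addr0 => [|j ji].
  by rewrite mderivX mnm1E eqxx -{1}[U_(i)%MM]add0m addmK mpolyX0 scale1r -mul_mpolyC mulr1.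
by rewrite mderivX mnm1E eq_sym (negbTE ji) scale0r scaler0.
Qed.

Lemma dirderivK_frac xi (p q : CV) : q != 0 ->
  dirderivK xi (p%:F / q%:F) =
  (dirderiv xi p * q - p * dirderiv xi q)%:F / (q ^+ 2)%:F.
Proof.
move=> q0; rewrite /dirderivK; have := fraction_cross p q0.
have := denom_ratioP (generic_quotient.repr (p%:F / q%:F)).
move: (\d_ _) (\n_ _) => d m d0 E.
apply/eqP; rewrite fraction_eq ?expf_neq0 //.
have := congr1 (dirderiv xi) E; rewrite !dirderivM.
move: (dirderiv xi p) (dirderiv xi d) (dirderiv xi m) (dirderiv xi q)
  => p' d' m' q' E'.
(* The differentiated cross relation gives m' q; the goal is regrouped so that the representative's
   numerator enters only through m' q and m q. *)
have F : m' * q = p' * d + p * d' - m * q' by rewrite E' addrK.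
apply/eqP.
have -> : (m' * d - m * d') * q ^+ 2 = (m' * q) * d * q - m * q * d' * q by ring.
rewrite F.
have -> : (p' * d + p * d' - m * q') * d * q - m * q * d' * q =
  (p' * d + p * d') * d * q - m * q * q' * d - m * q * d' * q by ring.
by rewrite -E; ring.
Qed.

Lemma dirderivK_tofrac xi (p : CV) : dirderivK xi p%:F = (dirderiv xi p)%:F.
Proof.
have -> : p%:F = p%:F / 1%:F :> KV by rewrite tofrac1 divr1.
rewrite dirderivK_frac ?oner_eq0 // -mpolyC1 dirderivC mulr0 subr0.
by rewrite mpolyC1 mulr1 expr1n tofrac1 divr1.
Qed.

Lemma dirderivKM xi (x y : KV) :
  dirderivK xi (x * y) = dirderivK xi x * y + x * dirderivK xi y.
Proof.
have [p [q [q0 ->]]] := fractionP x; have [r [s [s0 ->]]] := fractionP y.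
rewrite mulf_div -!tofracM !dirderivK_frac ?mulf_neq0 // !mulf_div -!tofracM.
rewrite addf_div ?tofrac_eq0 ?mulf_neq0 ?expf_neq0 // -!tofracM -tofracD.
apply/eqP; rewrite fraction_eq ?mulf_neq0 ?expf_neq0 // !dirderivM.
by apply/eqP; ring.
Qed.

Lemma dirderivKB xi : zmod_morphism (@dirderivK C n xi).
Proof.
move=> x y.
have [p [q [q0 ->]]] := fractionP x; have [r [s [s0 ->]]] := fractionP y.
rewrite -mulNr addf_div ?tofrac_eq0 // -tofracN -!tofracM -tofracD.
rewrite !dirderivK_frac ?mulf_neq0 // -[X in _ = _ + X]mulNr.
rewrite addf_div ?tofrac_eq0 ?expf_neq0 // -tofracN -!tofracM -tofracD.
apply/eqP; rewrite fraction_eq ?mulf_neq0 ?expf_neq0 //.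
rewrite raddfD /= !dirderivM [dirderiv xi (- r)]raddfN /=.
by apply/eqP; ring.
Qed.

HB.instance Definition _ xi :=
  GRing.isZmodMorphism.Build KV KV (dirderivK xi) (@dirderivKB xi).

Lemma dirderivK_const xi (c : C) : dirderivK xi (constK n c) = 0.
Proof. by rewrite dirderivK_tofrac dirderivC tofrac0. Qed.

Section Action.

Variables (W : finGroupType) (rW : mx_representation C [set: W]%G n).

Lemma polactB w : zmod_morphism (@polact C n W rW w).
Proof. by move=> p q; rewrite /polact raddfB. Qed.

HB.instance Definition _ w :=
  GRing.isZmodMorphism.Build CV CV (polact rW w) (polactB w).

Lemma polact_monoid w : monoid_morphism (@polact C n W rW w).
Proof. by split=> [|p q]; [exact: rmorph1 | exact: rmorphM]. Qed.

HB.instance Definition _ w :=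
  GRing.isMonoidMorphism.Build CV CV (polact rW w) (polact_monoid w).

Lemma polactZ w c p : polact rW w (c *: p) = c *: polact rW w p.
Proof. exact: comp_mpolyZ. Qed.

Lemma polactC w c : polact rW w c%:MP = c%:MP.
Proof. exact: comp_mpolyC. Qed.

Lemma polactX w i : polact rW w 'X_i = \sum_(j < n) rW (w^-1)%g i j *: 'X_j.
Proof. by rewrite /polact comp_mpolyXU -tnth_nth tnth_mktuple. Qed.

Lemma mpoly_hom_eq (B : comNzRingType) (f g : {rmorphism CV -> B}) :
  (forall c, f c%:MP = g c%:MP) -> (forall i, f 'X_i = g 'X_i) -> f =1 g.
Proof.
move=> fgC fgX p; rewrite (mpolyE p) !raddf_sum /=; apply: eq_bigr => m _.
rewrite -mul_mpolyC !rmorphM /= fgC mpolyXE_id !rmorph_prod.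
by congr (_ * _); apply: eq_bigr => i _; rewrite !rmorphXn /= fgX.
Qed.

(** Substitution and w |-> w^-1 both reverse products, so together they give a left action. *)
Lemma polactM u w p : polact rW (u * w) p = polact rW u (polact rW w p).
Proof.
suff E : polact rW (u * w) =1 polact rW u \o polact rW w by exact: E.
apply: (@mpoly_hom_eq _ (polact rW (u * w)) (polact rW u \o polact rW w)).
  by move=> c /=; rewrite !polactC.
move=> i /=; rewrite !polactX raddf_sum /=.
under [RHS]eq_bigr => j _ do rewrite polactZ polactX scaler_sumr.
rewrite exchange_big /=; apply: eq_bigr => j _.
under eq_bigr => l _ do rewrite scalerA.
by rewrite -scaler_suml invMg repr_mxM ?inE // mxE.
Qed.

Lemma polact1 p : polact rW 1 p = p.
Proof.
apply: (@mpoly_hom_eq _ (polact rW 1) idfun); first by move=> c; exact: polactC.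
move=> i /=; rewrite polactX invg1 repr_mx1 (bigD1 i) //= big1 ?addr0.
  by rewrite mxE eqxx scale1r.
by move=> j ji; rewrite mxE eq_sym (negbTE ji) scale0r.
Qed.

Lemma polactK w : cancel (polact rW w) (polact rW w^-1).
Proof. by move=> p; rewrite -polactM mulVg polact1. Qed.

Lemma polact_eq0 w p : (polact rW w p == 0) = (p == 0).
Proof. by rewrite (can2_eq (polactK w)) ?raddf0 // -{2}[w]invgK; exact: polactK. Qed.

Lemma polact_neq0 w p : p != 0 -> polact rW w p != 0.
Proof. by rewrite polact_eq0. Qed.

Lemma ratact_frac w (p q : CV) : q != 0 ->
  ratact rW w (p%:F / q%:F) = (polact rW w p)%:F / (polact rW w q)%:F.
Proof.
move=> q0; rewrite /ratact; have := fraction_cross p q0.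
have := denom_ratioP (generic_quotient.repr (p%:F / q%:F)).
move: (\d_ _) (\n_ _) => d m d0 E.
apply/eqP; rewrite fraction_eq; try exact: polact_neq0.
by rewrite -!rmorphM /= E.
Qed.

Lemma ratact_tofrac w (p : CV) : ratact rW w p%:F = (polact rW w p)%:F.
Proof.
have -> : p%:F = p%:F / 1%:F :> KV by rewrite tofrac1 divr1.
by rewrite ratact_frac ?oner_eq0 // rmorph1 tofrac1 divr1.
Qed.

Lemma ratactB w : zmod_morphism (@ratact C n W rW w).
Proof.
move=> x y.
have [p [q [q0 ->]]] := fractionP x; have [r [s [s0 ->]]] := fractionP y.
rewrite -mulNr addf_div ?tofrac_eq0 // -tofracN -!tofracM -tofracD.
rewrite (ratact_frac _ p q0) (ratact_frac _ r s0).
rewrite (ratact_frac _ _ (mulf_neq0 q0 s0)) -[X in _ = _ + X]mulNr.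
rewrite addf_div ?tofrac_eq0; try exact: polact_neq0.
rewrite -tofracN -!tofracM -tofracD.
by rewrite (raddfD (polact rW w)) /= !(rmorphM (polact rW w)) /= (raddfN (polact rW w)).
Qed.

HB.instance Definition _ w :=
  GRing.isZmodMorphism.Build KV KV (ratact rW w) (ratactB w).

Lemma ratact_monoid w : monoid_morphism (@ratact C n W rW w).
Proof.
split=> [|x y]; first by rewrite -tofrac1 ratact_tofrac rmorph1.
have [p [q [q0 ->]]] := fractionP x; have [r [s [s0 ->]]] := fractionP y.
rewrite mulf_div -!tofracM (ratact_frac _ p q0) (ratact_frac _ r s0).
rewrite (ratact_frac _ _ (mulf_neq0 q0 s0)) mulf_div -!tofracM.
by rewrite !(rmorphM (polact rW w)).
Qed.

HB.instance Definition _ w :=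
  GRing.isMonoidMorphism.Build KV KV (ratact rW w) (ratact_monoid w).

Lemma ratact_mul w x y : ratact rW w (x * y) = ratact rW w x * ratact rW w y.
Proof. exact: (rmorphM (ratact rW w)). Qed.

Lemma ratact_add w x y : ratact rW w (x + y) = ratact rW w x + ratact rW w y.
Proof. exact: (raddfD (ratact rW w)). Qed.

Lemma ratact_sub w x y : ratact rW w (x - y) = ratact rW w x - ratact rW w y.
Proof. exact: (raddfB (ratact rW w)). Qed.

Lemma ratact_sum w I (r : seq I) (P : pred I) (F : I -> KV) :
  ratact rW w (\sum_(i <- r | P i) F i) = \sum_(i <- r | P i) ratact rW w (F i).
Proof. exact: (raddf_sum (ratact rW w)). Qed.

Lemma polact_mul w p q : polact rW w (p * q) = polact rW w p * polact rW w q.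
Proof. exact: (rmorphM (polact rW w)). Qed.

Lemma polact_sub w p q : polact rW w (p - q) = polact rW w p - polact rW w q.
Proof. exact: (raddfB (polact rW w)). Qed.

Lemma polact_exp w p m : polact rW w (p ^+ m) = polact rW w p ^+ m.
Proof. exact: (rmorphXn (polact rW w)). Qed.

Lemma polact_sum w I (r : seq I) (P : pred I) (F : I -> CV) :
  polact rW w (\sum_(i <- r | P i) F i) = \sum_(i <- r | P i) polact rW w (F i).
Proof. exact: (raddf_sum (polact rW w)). Qed.

Lemma ratact_const w c : ratact rW w (constK n c) = constK n c.
Proof. by rewrite ratact_tofrac polactC. Qed.

Lemma ratactM u w x : ratact rW (u * w) x = ratact rW u (ratact rW w x).
Proof.
have [p [q [q0 ->]]] := fractionP x.
rewrite (ratact_frac (u * w) p q0) (ratact_frac w p q0).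
by rewrite (ratact_frac u _ (polact_neq0 w q0)) !polactM.
Qed.

Lemma ratact1 x : ratact rW 1 x = x.
Proof.
by have [p [q [q0 ->]]] := fractionP x; rewrite ratact_frac // !polact1.
Qed.

Lemma ratactK w : cancel (ratact rW w) (ratact rW w^-1).
Proof. by move=> x; rewrite -ratactM mulVg ratact1. Qed.

Lemma ratactKV w : cancel (ratact rW w^-1) (ratact rW w).
Proof. by move=> x; rewrite -ratactM mulgV ratact1. Qed.

End Action.

End FunctionFieldOperators.

(** * Linear maps and differential operators on C(V) *)

Section Operators.

Variables (C : fieldType) (n : nat).
Local Notation CV := {mpoly C[n]}.
Local Notation KV := {fraction CV}.
Implicit Types (D E : KV -> KV).

Section Clinear.

Variable D : KV -> KV.
Hypothesis linD : Clinear D.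

Lemma ClinearD x y : D (x + y) = D x + D y.
Proof. by have := linD 1 x y; rewrite rmorph1 !mul1r. Qed.

Lemma Clinear0 : D 0 = 0.
Proof. by apply: (@addrI _ (D 0)); rewrite -ClinearD !addr0. Qed.

Lemma ClinearZ c x : D (constK n c * x) = constK n c * D x.
Proof. by have := linD c x 0; rewrite Clinear0 !addr0. Qed.

Lemma ClinearN x : D (- x) = - D x.
Proof. by apply: (@addrI _ (D x)); rewrite -ClinearD !subrr Clinear0. Qed.

Lemma ClinearB x y : D (x - y) = D x - D y.
Proof. by rewrite ClinearD ClinearN. Qed.

Lemma Clinear_sum I (r : seq I) (P : pred I) (F : I -> KV) :
  D (\sum_(i <- r | P i) F i) = \sum_(i <- r | P i) D (F i).
Proof. exact: (big_morph D ClinearD Clinear0). Qed.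

End Clinear.

Lemma Clinear_id : Clinear (@id KV).
Proof. by []. Qed.

Lemma Clinear_zero : Clinear (fun _ : KV => 0 : KV).
Proof. by move=> c x y; rewrite mulr0 addr0. Qed.

Lemma Clinear_add D E : Clinear D -> Clinear E -> Clinear (fun x => D x + E x).
Proof.
by move=> lD lE c x y; rewrite lD lE mulrDr -!addrA; congr (_ + _); rewrite addrCA.
Qed.

Lemma Clinear_opp D : Clinear D -> Clinear (fun x => - D x).
Proof. by move=> lD c x y; rewrite lD mulrN opprD. Qed.

Lemma Clinear_comp D E : Clinear D -> Clinear E -> Clinear (D \o E).
Proof. by move=> lD lE c x y /=; rewrite lE lD. Qed.

Lemma Clinear_mulop (a : KV) : Clinear (mulop a).
Proof. by move=> c x y; rewrite /mulop mulrDr mulrCA. Qed.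

Lemma Clinear_dirderivK xi : Clinear (@dirderivK C n xi).
Proof.
move=> c x y; rewrite (raddfD (dirderivK xi)) /= dirderivKM dirderivK_const.
by rewrite mul0r add0r.
Qed.

Lemma Clinear_commutator D (a : KV) : Clinear D -> Clinear (fun x => D (a * x) - a * D x).
Proof.
move=> lD; apply: Clinear_add; first by apply: (Clinear_comp lD (Clinear_mulop a)).
by apply: Clinear_opp; apply: (Clinear_comp (Clinear_mulop a) lD).
Qed.

Lemma eq_diffop_lt m D E : D =1 E -> diffop_lt m D -> diffop_lt m E.
Proof. by move=> /funext ->. Qed.

Lemma diffop_lt_zero m : diffop_lt m (fun _ : KV => 0 : KV).
Proof.
elim: m => [|m IH] //= a; apply: eq_diffop_lt IH => x; by rewrite mulr0 subr0.
Qed.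

Lemma diffop_ltS m D : diffop_lt m D -> diffop_lt m.+1 D.
Proof.
elim: m D => [|m IH] D /= ltD a; first by move=> x; rewrite !ltD mulr0 subr0.
exact: (IH _ (ltD a)).
Qed.

Lemma diffop_lt_le m m' D : (m <= m')%N -> diffop_lt m D -> diffop_lt m' D.
Proof.
move=> /subnK <-; elim: (m' - m)%N => [|i IH] // ltD.
by rewrite addSn; apply: diffop_ltS; apply: IH.
Qed.

Lemma diffop_lt_add m D E :
  diffop_lt m D -> diffop_lt m E -> diffop_lt m (fun x => D x + E x).
Proof.
elim: m D E => [|m IH] D E /= ltD ltE; first by move=> x; rewrite ltD ltE addr0.
move=> a; apply: eq_diffop_lt (IH _ _ (ltD a) (ltE a)) => x.
by rewrite mulrDr opprD addrACA.
Qed.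

Lemma diffop_lt_sum I (r : seq I) m (F : I -> KV -> KV) :
  (forall i, diffop_lt m (F i)) -> diffop_lt m (fun x => \sum_(i <- r) F i x).
Proof.
move=> ltF; elim: r => [|i r IH].
  by apply: eq_diffop_lt (diffop_lt_zero m) => x; rewrite big_nil.
by apply: eq_diffop_lt (diffop_lt_add (ltF i) IH) => x; rewrite big_cons.
Qed.

Lemma diffop_lt_mull m (a : KV) D : diffop_lt m D -> diffop_lt m (fun x => a * D x).
Proof.
elim: m D => [|m IH] D /= ltD; first by move=> x; rewrite ltD mulr0.
by move=> b; apply: eq_diffop_lt (IH _ (ltD b)) => x; rewrite mulrBr mulrCA.
Qed.

Lemma diffop_lt_opp m D : diffop_lt m D -> diffop_lt m (fun x => - D x).
Proof.
move=> ltD; apply: eq_diffop_lt (diffop_lt_mull (-1) ltD) => x.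
by rewrite mulN1r.
Qed.

Lemma diffop_lt_mulop (a : KV) : diffop_lt 1 (mulop a).
Proof. by move=> b x; rewrite /mulop mulrCA subrr. Qed.

Lemma diffop_lt_dirderivK xi : diffop_lt 2 (@dirderivK C n xi).
Proof.
move=> a; apply: eq_diffop_lt (diffop_lt_mulop (dirderivK xi a)) => x.
by rewrite dirderivKM addrK.
Qed.

(** The bounds are strict: orders at most a - 1 and b - 1 compose to at most a + b - 2. Induction on
    a + b by the Leibniz rule [DE, c] = [D, c] E + D [E, c]. *)
Lemma diffop_lt_comp a b D E : Clinear D ->
  diffop_lt a D -> diffop_lt b E -> diffop_lt (a + b).-1 (D \o E).
Proof.
have [m] := ubnP (a + b); elim: m => // m IH in a b D E *.
case: a => [|a] ab linD ltD ltE.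
  by apply: eq_diffop_lt (diffop_lt_zero _) => x /=; rewrite ltD.
case: b => [|b] in ab ltE *.
  by apply: eq_diffop_lt (diffop_lt_zero _) => x /=; rewrite ltE Clinear0.
have -> : (a.+1 + b.+1).-1 = (a + b).+1 by rewrite addnS addSn.
move=> c.
have ltDE := IH a b.+1 _ E _ (Clinear_commutator c linD) (ltD c) ltE.
have ltED := IH a.+1 b D _ _ linD ltD (ltE c).
rewrite addnS /= in ltDE; rewrite addSn /= in ltED; rewrite addnS addSn ltnS in ab.
apply: eq_diffop_lt (diffop_lt_add (ltDE _) (ltED _)) => [x||]; rewrite ?addnS ?addSn //=.
rewrite (ClinearB linD); ring.
Qed.

Lemma commute_mul D : Clinear D ->
  (forall i x, D (('X_i : CV)%:F * x) = ('X_i : CV)%:F * D x) ->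
  forall a x, D (a * x) = a * D x.
Proof.
move=> linD DX.
have Dpow i k x : D (('X_i : CV)%:F ^+ k * x) = ('X_i : CV)%:F ^+ k * D x.
  by elim: k => [|k IH]; rewrite ?expr0 ?mul1r // exprS -!mulrA DX IH.
have Dpoly (p : CV) x : D (p%:F * x) = p%:F * D x.
  rewrite (mpolyE p) rmorph_sum /= !mulr_suml (Clinear_sum linD).
  apply: eq_bigr => m _; rewrite -mul_mpolyC rmorphM -!mulrA (ClinearZ linD).
  congr (_ * _); rewrite mpolyXE_id rmorph_prod /=.
  elim: (index_enum _) x => [|i r IH] x; first by rewrite big_nil !mul1r.
  by rewrite big_cons -!mulrA rmorphXn /= Dpow IH.
move=> a x; have [p [q [q0 ->]]] := fractionP a.
have qF0 : q%:F != 0 :> KV by rewrite tofrac_eq0.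
have E y : q%:F * (p%:F / q%:F * y) = p%:F * y.
  by rewrite mulrA mulrCA divff // mulr1.
by apply: (mulfI qF0); rewrite -Dpoly !E Dpoly.
Qed.

Section Conj.

Variables (W : finGroupType) (rW : mx_representation C [set: W]%G n).

Lemma Clinear_ratact w : Clinear (@ratact C n W rW w).
Proof. by move=> c x y; rewrite ratact_add ratact_mul ratact_const. Qed.

Lemma Clinear_conjop w D : Clinear D -> Clinear (conjop rW w D).
Proof.
move=> lD; apply: Clinear_comp (Clinear_ratact _).
exact: Clinear_comp (Clinear_ratact _) lD.
Qed.

(** The commutator of the conjugate with a is the conjugate of the commutator with w^-1 a. *)
Lemma diffop_lt_conjop m w D : diffop_lt m D -> diffop_lt m (conjop rW w D).
Proof.
elim: m D => [|m IH] D /= ltD; first by move=> x; rewrite /conjop /= ltD raddf0.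
move=> a; apply: eq_diffop_lt (IH _ (ltD (ratact rW w^-1 a))) => x.
by rewrite /conjop /= ratact_sub 2!ratact_mul ratactKV.
Qed.

End Conj.

End Operators.

Lemma multinom_ind (n : nat) (P : 'X_{1..n} -> Prop) :
  P 0%MM -> (forall m i, P m -> P (m + U_(i))%MM) -> forall m, P m.
Proof.
move=> P0 PU m; have [k] := ubnP (mdeg m); elim: k m => // k IH m mk.
have [->|m0] := eqVneq m 0%MM; first exact: P0.
have [i mi] : exists i, m i != 0%N.
  apply/existsP; apply: contraNT m0; rewrite negb_exists => /forallP m0.
  by apply/eqP/mnmP => i; rewrite mnm0E; apply/eqP; have := m0 i; rewrite negbK.
rewrite -(submK (m := U_(i)%MM) (m' := m)) ?lep1mP //; apply/PU/IH.
have : mdeg m = (mdeg (m - U_(i)) + 1)%N.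
  by rewrite -(mdeg1 i) -mdegD submK ?lep1mP.
by move=> E; rewrite E addn1 in mk.
Qed.

(** * Operators written as polynomials in the partial derivatives *)

Section OperatorsOfSymbols.

Variables (C : fieldType) (n : nat).
Local Notation CV := {mpoly C[n]}.
Local Notation KV := {fraction CV}.
Implicit Types (D E : KV -> KV) (p q : {mpoly KV[n]}).

(** Locked so that conversion does not unfold a partial derivative down to representatives of
    fractions. *)
Definition pderiv_def (i : 'I_n) : KV -> KV := dirderivK (delta_mx i ord0).
Fact pderiv_key : unit. Proof. by []. Qed.
Definition pderiv := locked_with pderiv_key pderiv_def.

Lemma pderivE i x : pderiv i x = dirderivK (delta_mx i ord0) x.
Proof. by rewrite /pderiv unlock. Qed.

Definition derivs (m : 'X_{1..n}) (x : KV) : KV :=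
  foldr (fun i y => iter (m i) (pderiv i) y) x (enum 'I_n).

(** [p] is the full symbol: its variables stand for the partial derivatives, and its coefficients
    are functions written to their left. *)
Definition Op p (x : KV) : KV := \sum_(m <- msupp p) p@_m * derivs m x.

Lemma pderivD i x y : pderiv i (x + y) = pderiv i x + pderiv i y.
Proof. by rewrite !pderivE (raddfD (dirderivK _)). Qed.

Lemma pderivB i x y : pderiv i (x - y) = pderiv i x - pderiv i y.
Proof. by rewrite !pderivE (raddfB (dirderivK _)). Qed.

Lemma pderivM i x y : pderiv i (x * y) = pderiv i x * y + x * pderiv i y.
Proof. by rewrite !pderivE dirderivKM. Qed.

Lemma pderiv_const i c : pderiv i (constK n c) = 0.
Proof. by rewrite pderivE dirderivK_const. Qed.

Lemma pderiv1 i : pderiv i 1 = 0.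
Proof. by rewrite -(rmorph1 (@constK C n)) pderiv_const. Qed.

Lemma pderivX i j : pderiv i ('X_j : CV)%:F = (i == j)%:R.
Proof.
rewrite pderivE dirderivK_tofrac dirderivX mxE eqxx andbT eq_sym.
by case: (_ == _); rewrite ?mpolyC1 ?tofrac1 // mpolyC0 tofrac0.
Qed.

Lemma Clinear_pderiv i : Clinear (pderiv i).
Proof. by move=> c x y; rewrite !pderivE Clinear_dirderivK. Qed.

Lemma diffop_lt_pderiv i : diffop_lt 2 (pderiv i).
Proof.
apply: eq_diffop_lt (diffop_lt_dirderivK (delta_mx i ord0)) => x.
by rewrite pderivE.
Qed.

(** The commutator of two partial derivatives commutes with the coordinates, so it is multiplication
    by its value at 1, which is 0. *)
Lemma pderiv_comm i j x : pderiv i (pderiv j x) = pderiv j (pderiv i x).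
Proof.
pose D y := pderiv i (pderiv j y) - pderiv j (pderiv i y).
have linD : Clinear D.
  apply: (Clinear_add (Clinear_comp (Clinear_pderiv i) (Clinear_pderiv j))).
  exact: Clinear_opp (Clinear_comp (Clinear_pderiv j) (Clinear_pderiv i)).
have DX l y : D (('X_l : CV)%:F * y) = ('X_l : CV)%:F * D y.
  have nat0 a (b : bool) : pderiv a (b%:R : KV) = 0.
    by case: b; rewrite ?pderiv1 //; exact: (Clinear0 (Clinear_pderiv _)).
  by rewrite /D !pderivM !pderivX !pderivD !pderivM !pderivX !nat0; ring.
apply/eqP; rewrite -subr_eq0 -/(D x) -[x]mulr1 (commute_mul linD DX).
by rewrite /D !pderiv1 !(Clinear0 (Clinear_pderiv _)) subrr mulr0.
Qed.

Lemma derivs0 x : derivs 0%MM x = x.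
Proof. by rewrite /derivs; elim: (enum _) => //= i s ->; rewrite mnm0E. Qed.

Lemma derivsU m i x : derivs (m + U_(i))%MM x = pderiv i (derivs m x).
Proof.
rewrite /derivs; have : i \in enum 'I_n by rewrite mem_enum.
have := enum_uniq 'I_n; elim: (enum 'I_n) => //= j s IH /andP[js us].
have iter_comm a l k y : iter k (pderiv a) (pderiv l y) = pderiv l (iter k (pderiv a) y).
  by elim: k => //= k ->; rewrite pderiv_comm.
rewrite inE => /orP[/eqP ij|si].
  subst j; rewrite mnmDE mnm1E eqxx addn1 /=; congr (pderiv i (iter _ _ _)).
  elim: s js {IH us} => //= l s IH; rewrite inE negb_or => /andP[il /IH ->].
  by rewrite mnmDE mnm1E (negbTE il) addn0.
rewrite (IH us si) iter_comm mnmDE mnm1E; case: (eqVneq i j) => [ij|_]; last by rewrite addn0.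
by rewrite -ij si in js.
Qed.

Lemma Clinear_derivs m : Clinear (derivs m).
Proof.
elim/multinom_ind: m => [|m i IH]; first by move=> c x y; rewrite !derivs0.
by move=> c x y; rewrite !derivsU IH (Clinear_pderiv i).
Qed.

(** When m i = 0 the truncated subtraction is harmless, since its term has coefficient 0. *)
Lemma derivs_mulX m i x : derivs m (('X_i : CV)%:F * x) =
  ('X_i : CV)%:F * derivs m x + (m i)%:R * derivs (m - U_(i))%MM x.
Proof.
elim/multinom_ind: m => [|m j IH].
  by rewrite mnm0E mul0r addr0 !derivs0.
rewrite !derivsU IH pderivD !pderivM pderivX mnmDE mnm1E natrD.
have -> : pderiv j (m i)%:R = 0.
  by rewrite -(rmorph_nat (@constK C n)) pderiv_const.
rewrite mul0r add0r [(j == i)%:R * _ + _]addrC -addrA; congr (_ + _).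
case: (altP (j =P i)) => [->|ji].
  rewrite mulr1n addmK mul1r mulrDl mul1r addrC.
  have [->|mi] := eqVneq (m i) 0%N; first by rewrite !mul0r.
  by rewrite -derivsU submK ?lep1mP.
rewrite mul0r add0r addr0.
have [->|mi] := eqVneq (m i) 0%N; first by rewrite !mul0r.
rewrite -derivsU; congr (_ * derivs _ _).
apply/mnmP => l; rewrite !(mnmDE, mnmBE, mnm1E).
case: (altP (i =P l)) => [<-|il]; rewrite ?subn0 //.
by rewrite (negbTE ji) !addn0.
Qed.

(** Gives symbols with different supports a common index range. *)
Lemma OpwE k p x : (msize p <= k)%N ->
  Op p x = \sum_(m : 'X_{1..n < k}) p@_m * derivs m x.
Proof.
move=> lt_pk; rewrite /Op (ssrcomplements.big_mksub 'X_{1..n < k}) ?msupp_uniq //=; first last.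
  by move=> m /msize_mdeg_lt /leq_trans; apply.
by rewrite big_rmcond //= => m /memN_msupp_eq0 ->; rewrite mul0r.
Qed.

Lemma Op0 x : Op 0 x = 0.
Proof. by rewrite /Op msupp0 big_nil. Qed.

Lemma OpD p q x : Op (p + q) x = Op p x + Op q x.
Proof.
pose k := maxn (msize (p + q)) (maxn (msize p) (msize q)).
rewrite !(@OpwE k) /k; try by rewrite !leq_max leqnn ?orbT.
by rewrite -big_split /=; apply: eq_bigr => m _; rewrite mcoeffD mulrDl.
Qed.

Lemma OpZ c p x : Op (c *: p) x = c * Op p x.
Proof.
rewrite (OpwE _ (msizeZ_le p c)) (OpwE _ (leqnn _)) mulr_sumr.
by apply: eq_bigr => m _; rewrite mcoeffZ mulrA.
Qed.

Lemma OpN p x : Op (- p) x = - Op p x.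
Proof. by rewrite -scaleN1r OpZ mulN1r. Qed.

Lemma OpB p q x : Op (p - q) x = Op p x - Op q x.
Proof. by rewrite OpD OpN. Qed.

Lemma OpX m x : Op 'X_[m] x = derivs m x.
Proof. by rewrite /Op msuppX big_seq1 mcoeffX eqxx mul1r. Qed.

Lemma OpC c x : Op c%:MP x = c * x.
Proof. by rewrite -[c%:MP]mulr1 mul_mpolyC OpZ -mpolyX0 OpX derivs0. Qed.

Lemma Clinear_Op p : Clinear (Op p).
Proof.
move=> c x y; rewrite /Op mulr_sumr -big_split; apply: eq_bigr => m _ /=.
by rewrite Clinear_derivs mulrDr mulrCA.
Qed.

(** Commutation with a coordinate is formal differentiation of the symbol; this turns questions
    about the order of an operator into questions about coefficients. *)
Lemma Op_mulX p i x : Op p (('X_i : CV)%:F * x) =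
  ('X_i : CV)%:F * Op p x + Op p^`M(i) x.
Proof.
elim/mpolyind: p => [|c m p _ _ IH]; first by rewrite mderiv0 !Op0 mulr0 addr0.
rewrite mderivD mderivZ mderivX !OpD IH !OpZ !OpX derivs_mulX; ring.
Qed.

Lemma Op_1 p : Op p 1 = p@_0%MM.
Proof.
elim/mpolyind: p => [|c m p _ _ IH]; first by rewrite Op0 mcoeff0.
rewrite OpD IH OpZ OpX mcoeffD mcoeffZ mcoeffX; congr (_ * _ + _).
elim/multinom_ind: m => [|m i IHm]; first by rewrite derivs0 eqxx.
rewrite derivsU IHm mnmD_eq0 mnm1_eq0 andbF.
by case: (m == _); rewrite ?pderiv1 //; exact: (Clinear0 (Clinear_pderiv _)).
Qed.

Lemma diffop_lt_derivs m : diffop_lt (mdeg m).+1 (derivs m).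
Proof.
elim/multinom_ind: m => [|m i IH].
  apply: eq_diffop_lt (@diffop_lt_le _ _ 1 _ _ _ (@diffop_lt_mulop C n 1)) => //.
  by move=> x; rewrite derivs0 /mulop mul1r.
rewrite mdegD mdeg1 addn1.
have := diffop_lt_comp (Clinear_pderiv i) (diffop_lt_pderiv i) IH.
by rewrite !addSn add0n; apply: eq_diffop_lt => x; rewrite /= derivsU.
Qed.

End OperatorsOfSymbols.

(** * Existence and uniqueness of symbols, and their behaviour under composition *)

Section SymbolCalculus.

Variables (C : numFieldType) (n : nat).
Local Notation CV := {mpoly C[n]}.
Local Notation KV := {fraction CV}.
Implicit Types (D E : KV -> KV) (p q : {mpoly KV[n]}).

Lemma msizeP (R : nzRingType) (p : {mpoly R[n]}) k :
  (forall m, (k <= mdeg m)%N -> p@_m = 0) <-> (msize p <= k)%N.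
Proof.
split=> [H|H m km]; last first.
  by apply/memN_msupp_eq0/msize_mdeg_ge/(leq_trans H km).
rewrite msizeE big_seq; elim/big_ind: _ => // [x y|m mp]; first by rewrite geq_max => -> ->.
by rewrite ltnNge; apply/negP => /H E; rewrite mcoeff_msupp E eqxx in mp.
Qed.

Lemma msizeM_le_pred (R : idomainType) (p q : {mpoly R[n]}) :
  (msize (p * q) <= (msize p + msize q).-1)%N.
Proof.
have [->|p0] := eqVneq p 0; first by rewrite mul0r mmeasure0.
have [->|q0] := eqVneq q 0; first by rewrite mulr0 mmeasure0.
by rewrite msizeM.
Qed.

Lemma msizeM_leS (R : idomainType) (p q : {mpoly R[n]}) a b :
  (msize p <= a.+1)%N -> (msize q <= b)%N -> (msize (p * q) <= a + b)%N.
Proof.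
move=> sp sq; apply: leq_trans (msizeM_le_pred _ _) _.
by move: (leq_add sp sq); rewrite addSn; case: (_ + msize q)%N.
Qed.

Lemma msizeX_le (R : idomainType) (p : {mpoly R[n]}) m r :
  (msize p <= m.+1)%N -> (msize (p ^+ r) <= (m * r).+1)%N.
Proof.
move=> sp; elim: r => [|r IH]; first by rewrite expr0 msize1 muln0.
by rewrite exprS mulnS -addnS msizeM_leS.
Qed.

Lemma constK_natr k : k%:R = constK n (k%:R : C) :> KV.
Proof. by rewrite rmorph_nat. Qed.

Lemma natrKV_neq0 k : (k.+1%:R : KV) != 0.
Proof. by rewrite constK_natr fmorph_eq0 pnatr_eq0. Qed.

Lemma natrKV_mulVn k (x : KV) : k != 0%N -> k%:R^-1 * x *+ k = x.
Proof.
by case: k => // k _; rewrite -[LHS]mulr_natr mulrC mulrA divff ?mul1r ?natrKV_neq0.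
Qed.

(** The constant coefficient is the value at 1. The hypothesis passes to a formal derivative of [p],
    which is a commutator with a coordinate, so any other coefficient is reached by differentiating
    and dividing by exponents, in characteristic zero. Taking vanishing for [P] gives uniqueness of
    symbols; taking polynomiality gives polynomial coefficients. *)
Lemma Op_coef_closed (P : KV -> Prop) p :
  (forall x y, P x -> P y -> P (x - y)) ->
  (forall f x, P x -> P ((f : CV)%:F * x)) ->
  (forall f : CV, P (Op p f%:F)) -> forall m, P p@_m.
Proof.
move=> PB PM Pp m; elim/multinom_ind: m p Pp => [|m i IH] p Pp.
  by rewrite -Op_1 -tofrac1; exact: Pp.
have Pd : P (p^`M(i))@_m.
  apply: IH => f; rewrite -[Op _ _](addKr (('X_i : CV)%:F * Op p f%:F)) -Op_mulX.
  by rewrite addrC -tofracM; apply: PB; [|apply: PM]; exact: Pp.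
rewrite mcoeff_deriv in Pd.
have E : ((m i).+1%:R^-1 : C)%:MP%:F * (p@_(m + U_(i))%MM *+ (m i).+1) = p@_(m + U_(i))%MM.
  rewrite -[p@_ _ *+ _]mulr_natl mulrA constK_natr -tofracM -mpolyCM mulVf ?pnatr_eq0 //.
  by rewrite mpolyC1 tofrac1 mul1r.
by rewrite -E; apply: PM.
Qed.

Lemma Op_inj p q : Op p =1 Op q -> p = q.
Proof.
move=> pq; apply/mpolyP => m; apply/eqP; rewrite -subr_eq0 -mcoeffB; apply/eqP.
apply: (@Op_coef_closed (fun x => x = 0)).
- by move=> x y -> ->; rewrite subr0.
- by move=> f x ->; rewrite mulr0.
- by move=> f; rewrite OpB pq subrr.
Qed.

(** By induction the commutators with the coordinates have symbols q_i. These form a closed family,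
    hence the formal gradient of some p, and D minus [Op p] commutes with all coordinates, so it is
    a multiplication. *)
Lemma diffop_lt_symbol m D : Clinear D -> diffop_lt m D ->
  exists2 p, (msize p <= m)%N & D =1 Op p.
Proof.
elim: m D => [|m IH] D linD ltD.
  by exists 0; rewrite ?mmeasure0 // => x; rewrite Op0 ltD.
have [q qP] : exists q : 'I_n -> {mpoly KV[n]}, forall i, (msize (q i) <= m)%N /\
    forall x, D (('X_i : CV)%:F * x) = ('X_i : CV)%:F * D x + Op (q i) x.
  apply: (@fin_all_exists _ _ (fun i q => (msize q <= m)%N /\
    forall x, D (('X_i : CV)%:F * x) = ('X_i : CV)%:F * D x + Op q x)) => i.
  have [q sq Eq] := IH _ (Clinear_commutator ('X_i)%:F linD) (ltD ('X_i)%:F).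
  by exists q; split=> // x; rewrite -Eq; ring.
(* The double commutator with two coordinates is symmetric in them. *)
have qC i j : (q i)^`M(j) = (q j)^`M(i).
  have H a b x : Op (q a)^`M(b) x = D (('X_b : CV)%:F * (('X_a : CV)%:F * x)) -
      ('X_a : CV)%:F * D (('X_b : CV)%:F * x) - ('X_b : CV)%:F * D (('X_a : CV)%:F * x)
      + ('X_a : CV)%:F * ('X_b : CV)%:F * D x.
    have -> : Op (q a)^`M(b) x = Op (q a) (('X_b : CV)%:F * x) - ('X_b : CV)%:F * Op (q a) x.
      by rewrite Op_mulX addrAC subrr add0r.
    have E y : Op (q a) y = D (('X_a : CV)%:F * y) - ('X_a : CV)%:F * D y.
      by have [_ ->] := qP a; rewrite addrAC subrr add0r.
    by rewrite !E mulrCA; ring.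
  by apply: Op_inj => x; rewrite !H mulrCA; ring.
(* Formal integration: divide by any nonzero exponent; closedness makes the choice immaterial. The
   constant coefficient, left at 0 here, is corrected at the end. *)
pose cf (l : 'X_{1..n}) : KV := if [pick i | l i != 0%N] is Some i
  then (l i)%:R^-1 * (q i)@_(l - U_(i))%MM else 0.
pose p := \sum_(l : 'X_{1..n < m.+1}) cf l *: 'X_[l].
have pE l : p@_l = if (mdeg l < m.+1)%N then cf l else 0.
  case: ifP => lm; first by rewrite /p mcoeff_mpoly.
  rewrite /p raddf_sum /= big1 // => l' _; rewrite mcoeffZ mcoeffX.
  case: eqP => [E|]; rewrite ?mulr0 //.
  by rewrite -E bmdeg in lm.
have sp : (msize p <= m.+1)%N.
  by apply/msizeP => l lm; rewrite pE ltnNge lm.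
have dp i : p^`M(i) = q i.
  apply/mpolyP => l; rewrite mcoeff_deriv pE mdegD mdeg1 addn1 ltnS.
  case: ifP => lm; last first.
    rewrite mul0rn; apply/esym/memN_msupp_eq0/msize_mdeg_ge.
    by apply: leq_trans (qP i).1 _; rewrite leqNgt lm.
  rewrite /cf; case: pickP => [j|/(_ i)]; last by rewrite mnmDE mnm1E eqxx addn1.
  have [<-|ij] := eqVneq i j.
    by rewrite addmK mnmDE mnm1E eqxx addn1 natrKV_mulVn.
  rewrite mnmDE mnm1E (negbTE ij) addn0 => lj.
  have E := congr1 (mcoeff (l - U_(j))%MM) (qC i j).
  rewrite !mcoeff_deriv submK ?lep1mP // mnmBE mnm1E eqxx subn1 prednK ?lt0n // in E.
  have F : (l + U_(i) - U_(j) = l - U_(j) + U_(i))%MM.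
    apply/mnmP => a; rewrite !(mnmDE, mnmBE, mnm1E).
    by move: lj; case: (altP (j =P a)) => [->|]; case: (altP (i =P _)) => //=; lia.
  have G : (l - U_(j))%MM i = l i by rewrite mnmBE mnm1E eq_sym (negbTE ij) subn0.
  rewrite G -F in E.
  by rewrite -mulrnAr -E mulrnAr natrKV_mulVn.
have linE : Clinear (fun x => D x - Op p x).
  exact: Clinear_add linD (Clinear_opp (Clinear_Op p)).
have comE i x : D (('X_i : CV)%:F * x) - Op p (('X_i : CV)%:F * x) =
    ('X_i : CV)%:F * (D x - Op p x).
  by rewrite Op_mulX dp (qP i).2; ring.
(* The multiplication operator that remains is determined by its value at 1. *)
exists (p + (D 1 - Op p 1)%:MP).
  apply: leq_trans (msizeD_le _ _) _; rewrite geq_max sp /=.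
  by apply: leq_trans (_ : 1 <= _)%N; rewrite // msizeC; case: (_ != _).
move=> x; rewrite OpD OpC; apply/eqP; rewrite addrC -subr_eq; apply/eqP.
by have := commute_mul linE comE x 1; rewrite mulr1 => ->; rewrite mulrC.
Qed.

(** By the Leibniz rule; [r] collects the differentiated coefficients, so only ['X_i * q] can raise
    the degree. *)
Lemma pderiv_Op i q : exists2 r, (msize r <= msize q)%N &
  forall x, pderiv i (Op q x) = Op ('X_i * q + r) x.
Proof.
exists (\sum_(m <- msupp q) pderiv i q@_m *: 'X_[m]).
  apply: leq_trans (msize_sum _ _ _) _; rewrite big_seq.
  elim/big_ind: _ => // [x y|m mq]; first by rewrite geq_max => -> ->.
  by apply: leq_trans (msizeZ_le _ _) _; rewrite msizeX msize_mdeg_lt.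
move=> x; rewrite {1}/Op (Clinear_sum (Clinear_pderiv i)).
rewrite OpD {3}(mpolyE q) mulr_sumr.
have Op_sum (F : 'X_{1..n} -> {mpoly KV[n]}) s :
    Op (\sum_(m <- s) F m) x = \sum_(m <- s) Op (F m) x.
  by elim: s => [|m s IH]; rewrite ?big_nil ?Op0 // !big_cons OpD IH.
rewrite !Op_sum -big_split; apply: eq_bigr => m _ /=.
by rewrite -scalerAr -mpolyXD addmC 2!OpZ 2!OpX derivsU pderivM addrC.
Qed.

Lemma derivs_Op m b q : (msize q <= b.+1)%N ->
  exists2 s, (msize (s - 'X_[m] * q) <= mdeg m + b)%N &
    forall x, derivs m (Op q x) = Op s x.
Proof.
move=> sq; elim/multinom_ind: m => [|m i [s ss sE]].
  exists q; last by move=> x; rewrite derivs0.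
  by rewrite mpolyX0 mul1r subrr mmeasure0.
have [r sr rE] := pderiv_Op i s.
have ss' : (msize s <= (mdeg m + b).+1)%N.
  rewrite -(subrK ('X_[m] * q) s); apply: leq_trans (msizeD_le _ _) _.
  rewrite geq_max (leq_trans ss) //=.
  apply: leq_trans (msizeM_le_pred _ _) _; by rewrite msizeX addSn /= -addnS leq_add2l.
exists ('X_i * s + r); last by move=> x; rewrite derivsU sE rE.
rewrite mdegD mdeg1 addn1 addSn.
have -> : 'X_i * s + r - 'X_[m + U_(i)] * q = 'X_i * (s - 'X_[m] * q) + r.
  by rewrite mulrBr mulrA -mpolyXD addmC addrAC.
apply: leq_trans (msizeD_le _ _) _; rewrite geq_max (leq_trans sr ss') andbT.
by apply: leq_trans (msizeM_le_pred _ _) _; rewrite msizeX mdeg1.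
Qed.

(** Since [msize] is the degree plus one, the error has degree below a + b: top symbols multiply. *)
Lemma Op_comp a b p q : (msize p <= a.+1)%N -> (msize q <= b.+1)%N ->
  exists2 s, (msize (s - p * q) <= a + b)%N & forall x, Op p (Op q x) = Op s x.
Proof.
move=> sp sq.
have [s sP] := fin_all_exists2 (fun l : 'X_{1..n < a.+1} => derivs_Op l sq).
move=> sE; exists (\sum_(l : 'X_{1..n < a.+1}) p@_l *: s l).
  rewrite {2}(mpolywE sp) mulr_suml -sumrB.
  apply: leq_trans (msize_sum _ _ _) _.
  elim/big_ind: _ => // [x y|l _]; first by rewrite geq_max => -> ->.
  rewrite -scalerAl -scalerBr; apply: leq_trans (msizeZ_le _ _) _.
  by apply: leq_trans (sP l) _; rewrite leq_add2r -ltnS bmdeg.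
move=> x; rewrite (OpwE _ sp).
have Op_sum (F : 'X_{1..n < a.+1} -> {mpoly KV[n]}) :
    Op (\sum_m F m) x = \sum_m Op (F m) x.
  elim: (index_enum _) => [|m t IH]; first by rewrite !big_nil Op0.
  by rewrite !big_cons OpD IH.
by rewrite Op_sum; apply: eq_bigr => l _; rewrite OpZ sE.
Qed.

End SymbolCalculus.

(** * Divisibility and prime elements in a domain *)

Section Divisibility.

Variable R : idomainType.
Implicit Types a b p q : R.

Definition divides a b := exists g, b = g * a.

(** Units are allowed; that two primes are not associated is expressed by non-divisibility. *)
Definition prime_elt a :=
  a != 0 /\ forall p q, divides a (p * q) -> divides a p \/ divides a q.

Lemma divides0 a : divides a 0.
Proof. by exists 0; rewrite mul0r. Qed.

Lemma dividesxx a : divides a a.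
Proof. by exists 1; rewrite mul1r. Qed.

Lemma divides_add a p q : divides a p -> divides a q -> divides a (p + q).
Proof. by move=> [x ->] [y ->]; exists (x + y); rewrite mulrDl. Qed.

Lemma divides_mull a b p : divides a p -> divides a (b * p).
Proof. by move=> [x ->]; exists (b * x); rewrite mulrA. Qed.

Lemma divides_mulr a b p : divides a p -> divides a (p * b).
Proof. by rewrite mulrC; apply: divides_mull. Qed.

Lemma divides_opp a p : divides a p -> divides a (- p).
Proof. by rewrite -mulN1r; apply: divides_mull. Qed.

Lemma divides_sub a p q : divides a p -> divides a q -> divides a (p - q).
Proof. by move=> ap aq; apply/divides_add/divides_opp. Qed.

Lemma divides_sum a I (r : seq I) (P : pred I) (F : I -> R) :
  (forall i, P i -> divides a (F i)) -> divides a (\sum_(i <- r | P i) F i).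
Proof.
by move=> aF; apply: (@big_ind _ (divides a)) aF; [exact: divides0 | exact: divides_add].
Qed.

Lemma divides_trans a b p : divides a b -> divides b p -> divides a p.
Proof. by move=> [x ->] [y ->]; exists (y * x); rewrite mulrA. Qed.

Lemma divides_mul a b p q : divides a p -> divides b q -> divides (a * b) (p * q).
Proof. by move=> [x ->] [y ->]; exists (x * y); rewrite mulrACA. Qed.

Lemma divides_exp a p m : divides a p -> divides (a ^+ m) (p ^+ m).
Proof. by move=> [x ->]; exists (x ^+ m); rewrite exprMn. Qed.

Lemma divides_exp_le a i j : (i <= j)%N -> divides (a ^+ i) (a ^+ j).
Proof. by move=> /subnK <-; exists (a ^+ (j - i)); rewrite exprD. Qed.

Lemma divides_prod (s : seq R) a : a \in s -> divides a (\prod_(x <- s) x).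
Proof. by move=> /perm_to_rem/(perm_big _) ->; rewrite big_cons; apply/divides_mulr/dividesxx. Qed.

Section Prime.

Variable a : R.
Hypothesis pa : prime_elt a.

Lemma prime_elt_divides_exp p m : divides a (p ^+ m.+1) -> divides a p.
Proof.
elim: m => [|m IH]; first by rewrite expr1.
by rewrite exprS => /(proj2 pa) [|/IH].
Qed.

Lemma prime_elt_Gauss b p m :
  ~ divides a b -> divides (a ^+ m) (b * p) -> divides (a ^+ m) p.
Proof.
move=> nab; elim: m => [_|m IH dm]; first by exists p; rewrite mulr1.
have [h hE] := IH (divides_trans (divides_exp_le a (leqnSn m)) dm).
have [g gE] := dm; have am0 : a ^+ m != 0 by rewrite expf_neq0 // (proj1 pa).
have : divides a (b * h).
  by exists g; apply: (mulIf am0); rewrite -mulrA -hE gE exprS mulrA.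
case/(proj2 pa) => // -[x xE]; exists x.
by rewrite hE xE exprS mulrA.
Qed.

(** If p had valuation v < m at a, the hypothesis would give (r + 1) v >= m r for all r, which fails
    at r = m. *)
Lemma divides_exp_of_powers p m :
  (forall r, divides (a ^+ (m * r)) (p ^+ r.+1)) -> divides (a ^+ m) p.
Proof.
move=> H; suff S v : (v <= m)%N -> divides (a ^+ v) p by exact: S.
elim: v => [_|v IH vm]; first by exists p; rewrite mulr1.
have [q qE] := IH (ltnW vm); have [g gE] := H m.
have av0 i : a ^+ i != 0 by rewrite expf_neq0 // (proj1 pa).
have [|h hE] := @prime_elt_divides_exp q m.
  (* From v <= m - 1 follows v (m + 1) <= m^2 - 1, so at least one factor [a] survives the
     cancellation; the predecessor sets it aside. *)
  exists (g * a ^+ (m * m - v * m.+1).-1).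
  apply: (mulIf (av0 (v * m.+1)%N)).
  rewrite {1}exprM -exprMn -qE gE -!mulrA -exprS -exprD.
  by congr (g * a ^+ _); nia.
by exists h; rewrite qE hE exprS mulrA.
Qed.

End Prime.

Lemma divides_prod_primes (s : seq R) p m :
  uniq s -> (forall a, a \in s -> prime_elt a) ->
  (forall a b, a \in s -> b \in s -> a != b -> ~ divides a b) ->
  (forall a, a \in s -> divides (a ^+ m) p) ->
  divides ((\prod_(a <- s) a) ^+ m) p.
Proof.
elim: s p => [|b s IH] p; first by exists p; rewrite big_nil expr1n mulr1.
move=> /= /andP[bs us] ps ds dp.
have [q qE] := dp b (mem_head _ _).
rewrite big_cons exprMn qE mulrC; apply: divides_mul; last exact: dividesxx.
apply: IH => //.
- by move=> a sa; apply: ps; rewrite inE sa orbT.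
- by move=> a c sa sc; apply: ds; rewrite inE ?sa ?sc orbT.
move=> a sa; have sa' : a \in b :: s by rewrite inE sa orbT.
have ab : a != b by apply: contraNneq bs => <-.
apply: (@prime_elt_Gauss _ (ps _ sa') (b ^+ m)); last first.
  by rewrite mulrC -qE; apply: dp.
(* For exponent 0 the element [a] would be a unit and hence divide [b]. *)
case: {qE dp} m => [|m].
  move=> [x xE]; have [a0 H] := ps _ sa'; apply: (ds _ _ sa' (mem_head _ _) ab).
  by exists (b * x); rewrite -mulrA -xE expr0 mulr1.
by move/(prime_elt_divides_exp (ps _ sa')); apply: ds; rewrite ?mem_head.
Qed.

(** Serves to view products in C[V] as constants of C[V][X]. Non-divisibility of the images already
    makes [f] injective on [s]. *)
Lemma divides_hom_prod_primes (S : idomainType) (f : {rmorphism S -> R})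
    (s : seq S) p m :
  uniq s -> (forall a : S, a \in s -> prime_elt (f a)) ->
  (forall a b : S, a \in s -> b \in s -> a != b -> ~ divides (f a) (f b)) ->
  (forall a : S, a \in s -> divides (f a ^+ m) p) ->
  divides (f ((\prod_(a <- s) a) ^+ m)) p.
Proof.
move=> us ps ds dp; have finj : {in s &, injective f}.
  move=> a b sa sb fab; apply/eqP; apply/negP => /negP /(ds _ _ sa sb) [].
  by rewrite fab; apply: dividesxx.
rewrite rmorphXn rmorph_prod /= -(big_map f xpredT id); apply: divides_prod_primes.
- by rewrite map_inj_in_uniq.
- by move=> _ /mapP[a sa ->]; apply: ps.
- move=> _ _ /mapP[a sa ->] /mapP[b sb ->] ab; apply: ds => //.
  by apply: contraNneq ab => ->.
- by move=> _ /mapP[a sa ->]; apply: dp.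
Qed.

Lemma prime_elt_of_hom (S : idomainType) (phi : {rmorphism R -> S}) a :
  a != 0 -> (forall p, divides a p <-> phi p = 0) -> prime_elt a.
Proof.
move=> a0 H; split=> // p q /H; rewrite rmorphM => /eqP.
by rewrite mulf_eq0 => /orP[] /eqP /H; [left|right].
Qed.

End Divisibility.

(** * Linear forms as prime elements *)

Section LinearForms.

Variables (C : fieldType) (n : nat).
Local Notation CV := {mpoly C[n]}.
Implicit Types (a : 'Hom('cV[C]_n, C^o)) (f : CV).

(** Congruence modulo [b] is compatible with sums and products, so the variables suffice. Used for
    the elimination of a coordinate and for the action of W_H modulo alpha_H. *)
Lemma hom_congr (b : CV) (g : {rmorphism CV -> CV}) :
  (forall c, g c%:MP = c%:MP) -> (forall i, divides b (g 'X_i - 'X_i)) ->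
  forall f, divides b (g f - f).
Proof.
move=> gC gX f; elim/mpolyind: f => [|c m f _ _ IH].
  by rewrite rmorph0 subr0; apply: divides0.
rewrite rmorphD /= opprD addrACA; apply: divides_add => //.
rewrite -mul_mpolyC rmorphM /= gC -mulrBr; apply: divides_mull.
elim/multinom_ind: m => [|m i IHm].
  by rewrite mpolyX0 rmorph1 subrr; apply: divides0.
rewrite mpolyXD rmorphM /=.
have -> : g 'X_[m] * g 'X_i - 'X_[m] * 'X_i =
  (g 'X_[m] - 'X_[m]) * g 'X_i + 'X_[m] * (g 'X_i - 'X_i) by ring.
by apply: divides_add; [apply: divides_mulr | apply: divides_mull].
Qed.

Lemma meval_linform a (v : 'cV[C]_n) : (linform a).@[fun j => v j ord0] = a v.
Proof.
rewrite /linform raddf_sum /= [in RHS](matrix_sum_delta v) !linear_sum /=.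
apply: eq_bigr => i _; rewrite big_ord1 [a (_ *: _)]linearZ /= mevalZ mevalXU mulrC.
by rewrite /GRing.scale.
Qed.

Lemma linform_eq0 a : (linform a == 0) = (a == 0).
Proof.
apply/eqP/eqP => [a0|->].
  by apply/lfunP => v; rewrite -meval_linform a0 meval0 lfunE.
by rewrite /linform big1 // => i _; rewrite lfunE scale0r.
Qed.

Lemma linform_divides a b : divides (linform a) (linform b) -> (lker a <= lker b)%VS.
Proof.
move=> [g gE]; apply/subvP => v; rewrite !memv_ker => /eqP av.
by rewrite -(meval_linform b) gE mevalM meval_linform av mulr0.
Qed.

(** Eliminate a coordinate x_j that occurs in a with coefficient c_j by x_j |-> x_j - a / c_j. This
    substitution kills a and is the identity modulo a, so its kernel is exactly the ideal of a; its
    target being a domain, a is prime. *)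
Lemma linform_kill a : a != 0 -> exists2 phi : {rmorphism CV -> CV},
  (forall c, phi c%:MP = c%:MP) & forall f, divides (linform a) f <-> phi f = 0.
Proof.
move=> a0.
have [j aj] : exists j : 'I_n, a (delta_mx j ord0) != 0.
  apply/existsP; apply: contraNT a0; rewrite negb_exists => /forallP H.
  apply/eqP/lfunP => v; rewrite lfunE /= (matrix_sum_delta v) !linear_sum big1 //= => i _.
  rewrite big_ord1 linearZ /=; have := H i; rewrite negbK => /eqP ->.
  by rewrite scaler0.
set cj := a _ in aj.
pose lq := [tuple 'X_i - (if i == j then cj^-1 *: linform a else 0) | i < n].
have phiX i : 'X_i \mPo lq = 'X_i - (if i == j then cj^-1 *: linform a else 0).
  by rewrite comp_mpolyXU -tnth_nth tnth_mktuple.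
have phia : linform a \mPo lq = 0.
  rewrite {1}/linform raddf_sum /=.
  under eq_bigr => i _ do rewrite comp_mpolyZ phiX scalerBr.
  rewrite sumrB -/(linform a) (bigD1 j) //= eqxx scalerA mulfV // scale1r.
  by rewrite big1 ?addr0 ?subrr // => i /negbTE ->; rewrite scaler0.
have phiD f : divides (linform a) (f \mPo lq - f).
  apply: (@hom_congr (linform a) (comp_mpoly lq)) => [c|i]; first exact: comp_mpolyC.
  rewrite /= phiX addrC addKr; apply: divides_opp.
  case: ifP => _; last exact: divides0.
  by rewrite -mul_mpolyC; apply/divides_mull/dividesxx.
exists (comp_mpoly lq) => [c|f]; first exact: comp_mpolyC.
split=> [[g ->]|f0]; first by rewrite rmorphM /= phia mulr0.
by have := divides_opp (phiD f); rewrite [comp_mpoly _ _]f0 sub0r opprK.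
Qed.

Lemma linform_prime a : a != 0 -> prime_elt (linform a).
Proof.
move=> a0; have [phi _ H] := linform_kill a0.
by apply: (@prime_elt_of_hom _ _ phi) => //; rewrite linform_eq0.
Qed.

Lemma dividesC_mpoly (R : idomainType) (b : R) (p : {mpoly R[n]}) :
  divides (b%:MP) p <-> forall m, divides b p@_m.
Proof.
split=> [[g ->] m|H]; first by exists g@_m; rewrite mulrC mcoeffCM mulrC.
have [g gE] : exists g : 'X_{1..n < msize p} -> R, forall l : 'X_{1..n < msize p}, p@_l = g l * b.
  exact: (@fin_all_exists _ (fun=> R : Type)
    (fun (l : 'X_{1..n < msize p}) x => p@_l = x * b) (fun l => H l)).
exists (\sum_(l : 'X_{1..n < msize p}) g l *: 'X_[l]).
rewrite {1}(mpolywE (leqnn (msize p))) mulr_suml; apply: eq_bigr => l _.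
by rewrite gE [RHS]mulrC mul_mpolyC scalerA mulrC.
Qed.

(** Applied to coefficients, the elimination still exhibits the ideal of a as the kernel of a map
    into a domain. *)
Lemma linform_prime_mpoly a : a != 0 -> prime_elt ((linform a)%:MP : {mpoly CV[n]}).
Proof.
move=> a0; have [phi _ H] := linform_kill a0.
apply: (@prime_elt_of_hom _ _ (map_mpoly phi)).
  by rewrite mpolyC_eq0 linform_eq0.
move=> p; rewrite dividesC_mpoly; split=> [dp|p0 m].
  by apply/mpolyP => m; rewrite mcoeff_map_mpoly mcoeff0; apply/H.
by apply/H; rewrite -mcoeff_map_mpoly p0 mcoeff0.
Qed.

End LinearForms.

(** * Polynomiality of the top symbol *)

Section PolynomialSymbol.

Variables (C : numFieldType) (n : nat).
Local Notation CV := {mpoly C[n]}.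
Local Notation KV := {fraction CV}.
Local Notation iota := (map_mpoly (n := n) (@FracField.tofrac CV)).
Implicit Types (p q : {mpoly KV[n]}).

Lemma Op_iter m b p q : (msize p <= m.+1)%N -> (msize q <= b.+1)%N -> forall r,
  exists2 s, (msize (s - p ^+ r * q) <= m * r + b)%N &
    forall x, iter r (Op p) (Op q x) = Op s x.
Proof.
move=> sp sq; elim=> [|r [s ss sE]].
  by exists q; rewrite // expr0 mul1r subrr mmeasure0.
have ss' : (msize s <= (m * r + b).+1)%N.
  rewrite -(subrK (p ^+ r * q) s); apply: leq_trans (msizeD_le _ _) _.
  by rewrite geq_max (leq_trans ss) //= -addnS msizeM_leS // msizeX_le.
have [s' ss'' sE'] := Op_comp sp ss'.
exists s'; last by move=> x; rewrite iterS sE sE'.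
have -> : s' - p ^+ r.+1 * q = (s' - p * s) + p * (s - p ^+ r * q).
  by rewrite exprS; ring.
rewrite mulnS -addnA; apply: leq_trans (msizeD_le _ _) _; rewrite geq_max ss'' /=.
exact: msizeM_leS.
Qed.

Lemma mcoeff_iota (P : {mpoly CV[n]}) m : (iota P)@_m = (P@_m)%:F.
Proof. exact: mcoeff_map_mpoly. Qed.

Lemma iota_inj : injective iota.
Proof.
move=> P Q PQ; apply/mpolyP => m; apply/eqP.
by rewrite -tofrac_eq -!mcoeff_iota PQ.
Qed.

Lemma mpoly_lift p : (forall m, exists g : CV, p@_m = g%:F) ->
  exists P, iota P = p.
Proof.
move=> H.
have [g gE] : exists g : 'X_{1..n < msize p} -> CV, forall l : 'X_{1..n < msize p}, p@_l = (g l)%:F.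
  exact: (@fin_all_exists _ (fun=> CV : Type)
    (fun (l : 'X_{1..n < msize p}) x => p@_l = x%:F) (fun l => H l)).
exists (\sum_(l : 'X_{1..n < msize p}) g l *: 'X_[l]).
rewrite [RHS](mpolywE (leqnn (msize p))) raddf_sum /=; apply: eq_bigr => l _.
by rewrite map_mpolyZ map_mpolyX gE.
Qed.

(* If D has symbol t, then D^r delta^N has symbol t^r delta^N; these being
   polynomial for all r with the same N forces every linear factor of the
   denominator of t to cancel. *)
Lemma polynomial_symbol (s : seq CV) N m p :
  uniq s -> (forall a, a \in s -> prime_elt (a%:MP : {mpoly CV[n]})) ->
  (forall a b, a \in s -> b \in s -> a != b -> ~ divides a b) ->
  (msize p <= m.+1)%N ->
  (forall r (f : CV), exists g : CV,
      iter r (Op p) (((\prod_(a <- s) a) ^+ N * f)%:F) = g%:F) ->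
  forall l, mdeg l = m -> exists g : CV, p@_l = g%:F.
Proof.
move=> us ps ds sp; have [d dE] : exists d, \prod_(a <- s) a = d by eexists.
rewrite dE => Hp.
have s0 a : a \in s -> a != 0 by move=> /ps[]; rewrite mpolyC_eq0.
have d0 : d != 0 by rewrite -dE prodf_seq_neq0; apply/allP => a /s0.
have dN0 : (d ^+ N)%:F != 0 :> KV by rewrite tofrac_eq0 expf_neq0.
pose t := pihomog mdeg m p.
have tE l : t@_l = if mdeg l == m then p@_l else 0.
  case: ifP => [/eqP ml|/negbT ml]; last first.
    exact: (dhomog_nemf_coeff (pihomogP _ _ _)).
  rewrite /t pihomogE (raddf_sum (mcoeff l)) /= big_mkcond /=.
  have [lp|lp] := boolP (l \in msupp p); last first.
    rewrite (memN_msupp_eq0 lp) big_seq big1 // => l' l'p.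
    case: ifP => // _; rewrite mcoeffZ mcoeffX.
    by case: eqP => [E|]; [rewrite -E l'p in lp | rewrite mulr0].
  rewrite (bigD1_seq l) ?msupp_uniq //= ml eqxx mcoeffZ mcoeffX eqxx mulr1.
  rewrite big1 ?addr0 // => l' /negbTE ll'; case: ifP => // _.
  by rewrite mcoeffZ mcoeffX ll' mulr0.
have st : (msize t <= m.+1)%N.
  by apply/msizeP => l ml; rewrite tE; case: eqP => // E; rewrite E ltnn in ml.
have spt : (msize (p - t) <= m)%N.
  apply/msizeP => l ml; rewrite mcoeffB tE; case: eqP => [_|E]; first by rewrite subrr.
  by rewrite subr0; move/msizeP: sp => ->; rewrite // ltn_neqAle eq_sym ml andbT; apply/eqP.
have sptr r : (msize (p ^+ r - t ^+ r) <= m * r)%N.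
  elim: r => [|r IH]; first by rewrite !expr0 subrr mmeasure0.
  have -> : p ^+ r.+1 - t ^+ r.+1 = p * (p ^+ r - t ^+ r) + (p - t) * t ^+ r.
    by rewrite !exprS; ring.
  rewrite mulnS; apply: leq_trans (msizeD_le _ _) _; rewrite geq_max.
  by rewrite msizeM_leS //= mulrC addnC msizeM_leS ?msizeX_le.
(* The coefficients of D^r delta^N are polynomial and agree with those of delta^N t^r in degree m r;
   in other degrees t^r vanishes by homogeneity. *)
have Pex r : exists P, iota P = (d ^+ N)%:F *: t ^+ r.
  apply: mpoly_lift => l; rewrite mcoeffZ.
  have sq : (msize ((d ^+ N)%:F%:MP : {mpoly KV[n]}) <= 1)%N.
    by rewrite msizeC; case: (_ != _).
  have [S sS SE] := Op_iter sp sq r.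
  have SC l' : exists g : CV, S@_l' = g%:F.
    apply: (@Op_coef_closed _ _ (fun x => exists g : CV, x = g%:F)).
    - by move=> x y [f ->] [g ->]; exists (f - g); rewrite tofracB.
    - by move=> f x [g ->]; exists (f * g); rewrite tofracM.
    by move=> f; rewrite -SE OpC -tofracM; apply: Hp.
  have [ml|/negP ml] := boolP (mdeg l == (m * r)%N); last first.
    exists 0; rewrite (_ : (t ^+ r)@_l = 0) ?mulr0 ?tofrac0 //.
    apply: (@dhomog_nemf_coeff _ _ mdeg (m * r)%N); last by apply/negP.
    exact/dhomogMn/pihomogP.
  have [g gE] := SC l; exists g; rewrite -gE.
  have : (p ^+ r - t ^+ r)@_l = 0 by move/msizeP: (sptr r) => ->; rewrite ?(eqP ml).
  have : (S - p ^+ r * (d ^+ N)%:F%:MP)@_l = 0.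
    by move/msizeP: sS => ->; rewrite ?(eqP ml) ?addn0.
  rewrite !mcoeffB [p ^+ r * _]mulrC mcoeffCM.
  by move=> /eqP; rewrite subr_eq0 => /eqP -> /eqP; rewrite subr_eq0 => /eqP ->.
have [P PE] := Pex 1%N; rewrite expr1 in PE.
have dP : divides ((d ^+ N)%:MP) P.
  rewrite -dE.
  apply: (@divides_hom_prod_primes _ _ (@mpolyC n CV)) => // a.
    move=> b sa sb ab /dividesC_mpoly/(_ 0%MM).
    by rewrite mcoeffC eqxx mulr1; apply: ds.
  move=> sa; apply: divides_exp_of_powers; first exact: ps.
  (* With P = delta^N t, the power P^(r+1) is delta^(N r) times the polynomial delta^N t^(r+1). *)
  move=> r; have [Q QE] := Pex r.+1.
  apply: (@divides_trans _ _ ((d ^+ (N * r))%:MP)).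
    rewrite -rmorphXn /=; apply/dividesC_mpoly => l; rewrite mcoeffC.
    by apply/divides_mulr/divides_exp; rewrite -dE; apply/divides_prod.
  exists Q; apply: iota_inj; rewrite rmorphXn /= PE rmorphM /= QE map_mpolyC /=.
  rewrite exprZn -scalerAl mulrC mul_mpolyC scalerA -rmorphXn -rmorphM /=.
  by rewrite -exprM -exprD mulnS.
have [G GE] := dP.
move=> l lm; exists G@_l.
have : (iota P)@_l = (d ^+ N)%:F * p@_l by rewrite PE mcoeffZ tE lm eqxx.
rewrite GE mcoeff_iota mulrC mcoeffCM tofracM => E.
by rewrite (mulfI dN0 E).
Qed.

End PolynomialSymbol.

(** Compare two block factorisations of the matrix with rows (1, -v) and (r, 1). Elements of W_H
    have the form 1 + v r. *)
Lemma det_one_add_mul (R : comNzRingType) n (v : 'cV[R]_n) (r : 'rV[R]_n) :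
  \det (1%:M + v *m r) = 1 + (r *m v) ord0 ord0.
Proof.
have E : block_mx (1%:M : 'M_n) 0 r (1%:M : 'M_1) *m block_mx 1%:M (- v) 0 (1%:M + r *m v)
    = block_mx 1%:M (- v) 0 1%:M *m block_mx (1%:M + v *m r) 0 r 1%:M.
  rewrite !mulmx_block !(mul1mx, mul0mx, mulmx0, mulmx1, mulmxN, mulNmx, addr0, add0r).
  by rewrite addrK addrC addrK.
have := congr1 determinant E; rewrite !det_mulmx !det_lblock !det_ublock !det1 !mul1r mulr1.
by move=> <-; rewrite det_mx11 !mxE.
Qed.

(** * Reflection hyperplanes, their linear forms and the groups W_H *)

Section ReflectionGeometry.

Variables (C : numFieldType) (n : nat) (W : finGroupType).
Variable rW : mx_representation C [set: W]%G n.
Hypothesis rW_faithful : mx_faithful rW.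
Variable alpha : {vspace 'cV[C]_n} -> 'Hom('cV[C]_n, C^o).
Hypothesis alpha_ker : forall H, H \in hyperplanes rW -> lker (alpha H) = H.
Local Notation CV := {mpoly C[n]}.
Implicit Types (a b : 'Hom('cV[C]_n, C^o)) (H : {vspace 'cV[C]_n}).

Lemma lactE w v : lact rW w v = rW w *m v.
Proof. by rewrite /lact lfunE. Qed.

Lemma rWM u w : rW (u * w)%g = rW u *m rW w.
Proof. by rewrite repr_mxM ?inE. Qed.

Lemma rWVK w (v : 'cV_n) : rW w^-1%g *m (rW w *m v) = v.
Proof. by rewrite mulmxA -rWM mulVg repr_mx1 mul1mx. Qed.

Lemma rWKV w (v : 'cV_n) : rW w *m (rW w^-1%g *m v) = v.
Proof. by rewrite mulmxA -rWM mulgV repr_mx1 mul1mx. Qed.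

Lemma hyperplanesP H : H \in hyperplanes rW ->
  exists2 w, is_reflection rW w & H = fixedSpace (lact rW w).
Proof.
by rewrite mem_undup => /mapP[w]; rewrite mem_filter => /andP[rw _] ->; exists w.
Qed.

Lemma hyperplane_dim H : H \in hyperplanes rW -> (\dim H).+1 = n.
Proof. by move=> /hyperplanesP[w rw ->]; apply/eqP. Qed.

Lemma dim_lact w (U : {vspace 'cV_n}) : \dim (lact rW w @: U)%VS = \dim U.
Proof.
apply: limg_dim_eq; apply/eqP; rewrite -subv0; apply/subvP => v.
rewrite memv_cap memv_ker memv0 lactE => /andP[_ /eqP v0].
by rewrite -(rWVK w v) v0 mulmx0.
Qed.

Lemma mem_lact w (U : {vspace 'cV_n}) v :
  (v \in (lact rW w @: U)%VS) = (rW w^-1%g *m v \in U).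
Proof.
apply/idP/idP => [/memv_imgP[x xU ->]|vU]; first by rewrite lactE rWVK.
by rewrite -[v](rWKV w) -lactE memv_img.
Qed.

Lemma fixedSpaceE w v : (v \in fixedSpace (lact rW w)) = (rW w *m v == v).
Proof. by apply/fixedSpaceP/eqP; rewrite lactE. Qed.

Lemma fixedSpace_lact u w :
  (lact rW w @: fixedSpace (lact rW u) = fixedSpace (lact rW (w * u * w^-1)%g))%VS.
Proof.
apply/vspaceP => v; rewrite mem_lact !fixedSpaceE !rWM -!mulmxA.
by apply/eqP/eqP => [->|E]; [rewrite rWKV | rewrite -{2}E rWVK].
Qed.

Lemma hyperplane_lact w H : H \in hyperplanes rW ->
  (lact rW w @: H)%VS \in hyperplanes rW.
Proof.
move=> HH; have [u /eqP ru E] := hyperplanesP HH.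
rewrite mem_undup; apply/mapP; exists (w * u * w^-1)%g; last by rewrite E fixedSpace_lact.
rewrite mem_filter mem_enum andbT /is_reflection -fixedSpace_lact dim_lact.
exact/eqP.
Qed.

Lemma lact_lact u w (U : {vspace 'cV_n}) :
  (lact rW u @: (lact rW w @: U) = lact rW (u * w)%g @: U)%VS.
Proof. by apply/vspaceP => v; rewrite !mem_lact mulmxA -rWM invMg. Qed.

Lemma lact1 (U : {vspace 'cV_n}) : (lact rW 1%g @: U = U)%VS.
Proof. by apply/vspaceP => v; rewrite mem_lact invg1 repr_mx1 mul1mx. Qed.

Lemma alpha_neq0 H : H \in hyperplanes rW -> alpha H != 0.
Proof.
move=> HH; apply/eqP => a0; have := alpha_ker HH.
have -> : lker (alpha H) = fullv.
  by apply/vspaceP => v; rewrite memv_ker a0 lfunE /= eqxx memvf.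
move=> E; have := hyperplane_dim HH; rewrite -E dimvf /dim /= muln1.
by move/eqP; rewrite eqn_leq ltnn.
Qed.

Lemma linform_alpha_neq0 H : H \in hyperplanes rW -> linform (alpha H) != 0.
Proof. by move=> HH; rewrite linform_eq0 alpha_neq0. Qed.

(** Divisibility would include one hyperplane in another of the same dimension. *)
Lemma linform_alpha_Ndivides H H' : H \in hyperplanes rW -> H' \in hyperplanes rW ->
  H != H' -> ~ divides (linform (alpha H)) (linform (alpha H')).
Proof.
move=> HH HH' HnH' /linform_divides; rewrite !alpha_ker // => sHH'.
case/negP: HnH'; rewrite eqEdim sHH' /=.
by rewrite -ltnS (hyperplane_dim HH) (hyperplane_dim HH').
Qed.

Lemma linform_scale (c : C) a : linform (c *: a) = c *: linform a.
Proof.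
rewrite /linform scaler_sumr; apply: eq_bigr => i _.
by rewrite lfunE /= scalerA.
Qed.

Lemma polact_linform w a : polact rW w (linform a) = linform (a \o lact rW w^-1)%VF.
Proof.
rewrite /linform polact_sum.
under eq_bigr => i _ do rewrite polactZ polactX scaler_sumr.
rewrite exchange_big /=; apply: eq_bigr => j _.
under eq_bigr => i _ do rewrite scalerA.
rewrite -scaler_suml; congr (_ *: _).
rewrite comp_lfunE lactE /= (matrix_sum_delta (_ *m _)) linear_sum /=.
apply: eq_bigr => i _; rewrite big_ord1 linearZ /= mulrC; congr (_ * _).
rewrite mxE (bigD1 j) //= mxE !eqxx mulr1 big1 ?addr0 // => l lj.
by rewrite mxE (negbTE lj) mulr0.
Qed.

Lemma alpha_surj H : H \in hyperplanes rW -> exists x, alpha H x = 1.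
Proof.
move=> HH; have /eqP a0 := alpha_neq0 HH.
have [x ax] : exists x, alpha H x != 0.
  apply: contrapT => /forallNP a0'; apply: a0; apply/lfunP => x.
  by rewrite lfunE /=; apply: contrapT => /eqP; apply: a0'.
by exists ((alpha H x)^-1 *: x); rewrite linearZ /= /GRing.scale /= mulVf.
Qed.

Lemma proportional_forms a H : H \in hyperplanes rW -> (H <= lker a)%VS ->
  exists c, a = c *: alpha H.
Proof.
move=> HH sHa; have [x ax] := alpha_surj HH; exists (a x); apply/lfunP => v.
have : v - alpha H v *: x \in H.
  rewrite -{2}(alpha_ker HH) memv_ker linearB linearZ /= ax /GRing.scale /=.
  by rewrite mulr1 subrr.
move/(subvP sHa); rewrite memv_ker linearB linearZ /= subr_eq0 => /eqP ->.
by rewrite lfunE /= /GRing.scale /= mulrC.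
Qed.

(** The form w alpha_H vanishes on wH, and forms vanishing on a hyperplane are proportional. *)
Lemma polact_alpha w H : H \in hyperplanes rW -> exists2 c, c != 0 &
  polact rW w (linform (alpha H)) = c *: linform (alpha (lact rW w @: H)%VS).
Proof.
move=> HH; rewrite polact_linform.
have [|c cE] := @proportional_forms (alpha H \o lact rW w^-1)%VF _ (hyperplane_lact w HH).
  apply/subvP => v; rewrite mem_lact -{1}(alpha_ker HH) !memv_ker.
  by rewrite comp_lfunE lactE.
exists c; last by rewrite cE linform_scale.
apply: contraTneq (linform_alpha_neq0 HH) => c0.
by rewrite negbK -(polact_eq0 rW w) polact_linform cE c0 scale0r linform_eq0.
Qed.

Lemma mem_hstab H w : (w \in hstab rW H) = (H <= fixedSpace (lact rW w))%VS.
Proof. by rewrite inE. Qed.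

Lemma hstabP H w : reflect (forall v, v \in H -> rW w *m v = v) (w \in hstab rW H).
Proof.
rewrite mem_hstab; apply: (iffP subvP) => h v /h.
  by rewrite fixedSpaceE => /eqP.
by move=> E; rewrite fixedSpaceE; apply/eqP.
Qed.

Lemma hstab1 H : 1%g \in hstab rW H.
Proof. by apply/hstabP => v _; rewrite repr_mx1 mul1mx. Qed.

Lemma hstabM H u w : u \in hstab rW H -> w \in hstab rW H -> (u * w)%g \in hstab rW H.
Proof.
move=> /hstabP uH /hstabP wH; apply/hstabP => v vH.
by rewrite rWM -mulmxA wH // uH.
Qed.

Lemma group_set_hstab H : group_set (hstab rW H).
Proof. by apply/group_setP; split; [exact: hstab1 | exact: hstabM]. Qed.

Canonical hstab_group H := Group (group_set_hstab H).

Lemma hstab_lact w H u :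
  (u \in hstab rW (lact rW w @: H)%VS) = ((w^-1 * u * w)%g \in hstab rW H).
Proof.
apply/hstabP/hstabP => uH v.
  move=> vH; rewrite !rWM -!mulmxA uH ?rWVK //.
  by rewrite mem_lact rWVK.
rewrite mem_lact => /uH; rewrite !rWM -!mulmxA rWKV.
by move/(congr1 (mulmx (rW w))); rewrite !rWKV.
Qed.

Lemma hord_lact w H : hord rW (lact rW w @: H)%VS = hord rW H.
Proof.
rewrite /hord -(cardJg (hstab rW H) w^-1%g); apply: eq_card => u.
by rewrite hstab_lact mem_conjg conjgE !invgK mulgA.
Qed.

Lemma hord_gt0 H : (0 < hord rW H)%N.
Proof. exact: (cardG_gt0 (hstab_group H)). Qed.

(** Fixing H pointwise, u is a rank one perturbation of the identity, with v0 = u x0 - x0 for any x0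
    such that alpha_H(x0) = 1. *)
Lemma det_hstab H u : H \in hyperplanes rW -> u \in hstab rW H ->
  exists v0, [/\ \det (rW u) = 1 + alpha H v0
    & forall x, rW u *m x = x + alpha H x *: v0].
Proof.
move=> HH /hstabP uH; have [x0 ax0] := alpha_surj HH.
pose v0 := rW u *m x0 - x0; exists v0.
have uE x : rW u *m x = x + alpha H x *: v0.
  have : x - alpha H x *: x0 \in H.
    rewrite -{2}(alpha_ker HH) memv_ker linearB linearZ /= ax0 /GRing.scale /=.
    by rewrite mulr1 subrr.
  move/uH; rewrite mulmxBr -scalemxAr => /eqP; rewrite subr_eq => /eqP ->.
  by rewrite /v0 scalerBr -addrA; congr (_ + _); rewrite addrC.
split=> //; pose r : 'rV[C]_n := \row_j alpha H (delta_mx j ord0).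
have rE x : (r *m x) ord0 ord0 = alpha H x.
  rewrite mxE [in RHS](matrix_sum_delta x) linear_sum; apply: eq_bigr => i _ /=.
  by rewrite big_ord1 linearZ mxE /= mulrC.
rewrite -rE -det_one_add_mul; congr (\det _); apply/matrixP => i j.
have := congr1 (fun M : 'cV_n => M i ord0) (uE (delta_mx j ord0)).
rewrite -colE mxE => ->; rewrite !mxE eqxx andbT; congr (_ + _).
by rewrite big_ord1 !mxE mulrC.
Qed.

Lemma det_repr_neq0 u : \det (rW u) != 0.
Proof.
have : \det (rW u *m rW u^-1%g) = 1 by rewrite -rWM mulgV repr_mx1 det1.
by rewrite det_mulmx; apply: contra_eq_neq => ->; rewrite mul0r eq_sym oner_eq0.
Qed.

Lemma detM u w : \det (rW (u * w)%g) = \det (rW u) * \det (rW w).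
Proof. by rewrite rWM det_mulmx. Qed.

Lemma det1g : \det (rW 1%g) = 1.
Proof. by rewrite repr_mx1 det1. Qed.

Lemma detV u : \det (rW u^-1%g) = (\det (rW u))^-1.
Proof.
by apply: (mulfI (det_repr_neq0 u)); rewrite -detM mulgV det1g divff ?det_repr_neq0.
Qed.

Lemma detX u m : \det (rW (u ^+ m)%g) = \det (rW u) ^+ m.
Proof. by elim: m => [|m IH]; rewrite ?expg0 ?det1g // expgS detM IH exprS. Qed.

Lemma det_hstab_order H u : u \in hstab rW H -> \det (rW u) ^+ hord rW H = 1.
Proof.
move=> uH; rewrite -detX (_ : u ^+ _ = 1)%g ?det1g //.
by apply/eqP; rewrite -order_dvdn (order_dvdG (G := hstab_group H)).
Qed.

(** Determinant 1 means alpha_H(v0) = 0, so u^m x = x + m alpha_H(x) v0; finite order in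
    characteristic zero then makes u trivial. Thus det is injective on W_H. *)
Lemma det_hstab_eq1 H u : H \in hyperplanes rW -> u \in hstab rW H ->
  \det (rW u) = 1 -> u = 1%g.
Proof.
move=> HH uH; have [v0 [-> uE]] := det_hstab HH uH.
move=> /(canRL (addKr _)); rewrite addNr => av0.
have powE m x : rW (u ^+ m)%g *m x = x + m%:R *: (alpha H x *: v0).
  elim: m => [|m IH]; first by rewrite expg0 repr_mx1 mul1mx scale0r addr0.
  rewrite expgS rWM -mulmxA IH uE linearD /= !linearZ /= av0 scaler0 scaler0 addr0.
  by rewrite -natr1 scalerDl scale1r scalerDr addrA.
have triv (x : 'cV_n) : rW u *m x = x.
  have := powE #[u]%g x; rewrite expg_order repr_mx1 mul1mx => /esym /eqP.
  rewrite -subr_eq0 addrC addKr scaler_eq0 pnatr_eq0 -leqn0 leqNgt order_gt0 /=.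
  by rewrite uE => /eqP ->; rewrite addr0.
have ru : rW u = rW 1%g.
  rewrite repr_mx1; apply/matrixP => i j.
  have := congr1 (fun M : 'cV_n => M i ord0) (triv (delta_mx j ord0)).
  by rewrite -colE !mxE eqxx andbT.
by apply: (mx_faithful_inj rW_faithful); rewrite ?inE.
Qed.

Lemma polact_alpha_hstab H u : H \in hyperplanes rW -> u \in hstab rW H ->
  polact rW u (linform (alpha H)) = (\det (rW u))^-1 *: linform (alpha H).
Proof.
move=> HH uH; rewrite polact_linform -linform_scale -detV; congr (linform _).
have [v0 [-> uE]] := det_hstab HH (groupVr (G := hstab_group H) uH).
apply/lfunP => x; rewrite comp_lfunE lactE uE lfunE /= linearD linearZ /=.
by rewrite /GRing.scale /= mulrDl mul1r mulrC.
Qed.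

Lemma polact_congr H u f : H \in hyperplanes rW -> u \in hstab rW H ->
  divides (linform (alpha H)) (polact rW u f - f).
Proof.
move=> HH uH; have [v0 [_ uE]] := det_hstab HH (groupVr (G := hstab_group H) uH).
apply: (@hom_congr _ _ (linform (alpha H)) (polact rW u)) => [c|i]; first exact: polactC.
exists (v0 i ord0)%:MP; rewrite /= polactX /linform mulr_sumr.
have -> : 'X_i = \sum_(j < n) (i == j)%:R *: ('X_j : CV).
  rewrite (bigD1 i) //= eqxx scale1r big1 ?addr0 // => j ji.
  by rewrite eq_sym (negbTE ji) scale0r.
rewrite -sumrB; apply: eq_bigr => j _; rewrite -scalerBl mul_mpolyC scalerA; congr (_ *: _).
have := congr1 (fun M : 'cV_n => M i ord0) (uE (delta_mx j ord0)).
rewrite -colE mxE => ->; rewrite !mxE eqxx andbT.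
by rewrite addrAC subrr add0r mulrC.
Qed.

End ReflectionGeometry.

(** The algebra behind [vqi_dunkl]: [P] is a power of a = alpha_H with exponent y, x is alpha_H(xi),
    and s is the sum over the idempotents. *)
Lemma derivation_exp_identity (R : comNzRingType) (a P dg dP g x y s : R) :
  a * dP = x * y * P ->
  (dg * P + g * dP) * a - x * (s * P) = (a * dg + x * (y * g - s)) * P.
Proof.
by move=> H; rewrite mulrDl -(mulrA g) [dP * a]mulrC H; ring.
Qed.

(** * Vector-valued quasi-invariants and their stability under Dunkl operators *)

Section QuasiInvariants.

Variables (C : numFieldType) (n : nat) (W : finGroupType).
Variable rW : mx_representation C [set: W]%G n.
Hypothesis rW_faithful : mx_faithful rW.
Variable alpha : {vspace 'cV[C]_n} -> 'Hom('cV[C]_n, C^o).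
Hypothesis alpha_ker : forall H, H \in hyperplanes rW -> lker (alpha H) = H.
Variable k : {vspace 'cV[C]_n} -> nat -> nat.
Local Notation CV := {mpoly C[n]}.
Local Notation lform H := (linform (alpha H)).
Local Notation chi u := (\det (rW u)).
Implicit Types (H : {vspace 'cV[C]_n}) (f g : CV) (F G : W -> CV) (l : int).

Definition rproj H (j : int) F : W -> CV :=
  fun v => \sum_(u : W) idem_H rW H j u *: F (u^-1 * v)%g.

(* F stands for the element \sum_v F(v) (x) v of C[V] (x) CW, on which W acts
   diagonally and e_{H,j} through the second factor. *)
Definition vector_quasi_invariant F : Prop :=
  forall H, H \in hyperplanes rW -> forall j, (j < hord rW H)%N -> forall v,
    divides (lform H ^+ (hord rW H * k H j)) (rproj H j%:Z F v).

Definition translate (w : W) F : W -> CV := fun v => polact rW w (F (w^-1 * v)%g).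

(** The numerator over alpha_H in the Dunkl operator, for the diagonal action; polynomials go to
    polynomials once alpha_H divides it. *)
Definition residue H F : W -> CV := fun v =>
  \sum_(i < hord rW H) (hord rW H * k H i)%:R *:
     \sum_(w : W) idem_H rW H i%:Z w *: translate w F v.

Lemma hordC_neq0 H : (hord rW H)%:R != 0 :> C.
Proof. by rewrite pnatr_eq0 -lt0n hord_gt0. Qed.

Lemma idem_H_out H l u : u \notin hstab rW H -> idem_H rW H l u = 0.
Proof. by rewrite /idem_H => /negbTE ->. Qed.

Lemma idem_H_in H l u : u \in hstab rW H ->
  idem_H rW H l u = (hord rW H)%:R^-1 * chi u ^ (- l).
Proof. by rewrite /idem_H => ->. Qed.

Lemma hstab_mulr H t w : w \in hstab rW H -> ((t * w)%g \in hstab rW H) = (t \in hstab rW H).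
Proof. exact: (@groupMr _ (hstab_group rW H)). Qed.

Lemma hstab_mull H t w : w \in hstab rW H -> ((w * t)%g \in hstab rW H) = (t \in hstab rW H).
Proof. exact: (@groupMl _ (hstab_group rW H)). Qed.

Lemma hstabV H w : (w^-1%g \in hstab rW H) = (w \in hstab rW H).
Proof. exact: (@groupV _ (hstab_group rW H)). Qed.

(** The coefficients in the exchange of 1 (x) e_{H,j} with the diagonal e_{H,i}: the displaced power
    of det(w) leaves e_{H,i-j} on the polynomial factor. *)
Lemma idem_H_mul H (i j : int) t w :
  idem_H rW H j (t * w^-1)%g * idem_H rW H i w =
  idem_H rW H (i - j) w * idem_H rW H j t.
Proof.
have [wH|wH] := boolP (w \in hstab rW H); last by rewrite !(idem_H_out _ wH) mulr0 mul0r.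
have [tH|tH] := boolP (t \in hstab rW H); last first.
  by rewrite (idem_H_out _ tH) mulr0 idem_H_out ?mul0r // hstab_mulr // hstabV.
rewrite !idem_H_in ?hstab_mulr ?hstabV // detM detV opprB.
rewrite exprzMl ?unitfE ?invr_eq0 ?det_repr_neq0 // exprz_inv opprK.
rewrite expfzDr ?det_repr_neq0 //; ring.
Qed.

(** On W_H this is a geometric sum in the n_H-th root of unity (det u)^-1, which differs from 1
    unless u = 1. *)
Lemma sum_idem_H H u : H \in hyperplanes rW ->
  \sum_(j < hord rW H) idem_H rW H j%:Z u = (u == 1%g)%:R.
Proof.
move=> HH; have [uH|uH] := boolP (u \in hstab rW H); last first.
  rewrite big1 => [|j _]; last by rewrite idem_H_out.
  by case: eqP => // u1; rewrite u1 hstab1 in uH.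
under eq_bigr => j _ do rewrite idem_H_in // -exprnN -exprVn.
rewrite -mulr_sumr; set z := (chi u)^-1.
have zn : z ^+ hord rW H = 1 by rewrite exprVn det_hstab_order ?invr1.
case: eqP => [u1|u1].
  have z1 : z = 1 by rewrite /z u1 det1g invr1.
  under eq_bigr => j _ do rewrite z1 expr1n.
  by rewrite sumr_const card_ord mulVf ?hordC_neq0.
have z1 : z - 1 != 0.
  rewrite subr_eq0; apply/eqP => /(canRL invrK); rewrite invr1 => z1.
  by apply: u1; apply: (det_hstab_eq1 rW_faithful alpha_ker HH uH z1).
have : (z - 1) * \sum_(j < hord rW H) z ^+ j = 0 by rewrite -subrX1 zn subrr.
by move/eqP; rewrite mulf_eq0 (negbTE z1) /= => /eqP ->; rewrite mulr0.
Qed.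

Lemma polact_gact_idem H l u f : u \in hstab rW H ->
  polact rW u (Defs.gact rW (idem_H rW H l) f) = chi u ^ l *: Defs.gact rW (idem_H rW H l) f.
Proof.
move=> uH; rewrite /Defs.gact polact_sum scaler_sumr [RHS](reindex_inj (mulgI u)) /=.
apply: eq_bigr => w _; rewrite polactZ -polactM scalerA; congr (_ *: _).
have [wH|wH] := boolP (w \in hstab rW H); last first.
  by rewrite !idem_H_out ?mulr0 // hstab_mull.
rewrite !idem_H_in ?hstab_mull // detM exprzMl ?unitfE ?det_repr_neq0 //.
by rewrite [RHS]mulrCA [chi u ^ l * _]mulrA -expfzDr ?det_repr_neq0 // subrr expr0z mul1r.
Qed.

Lemma exists_character_neq1 H (i j : nat) : H \in hyperplanes rW ->
  (i < hord rW H)%N -> (j < hord rW H)%N -> i != j ->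
  exists2 u, u \in hstab rW H & chi u ^ (i%:Z - j%:Z) != 1.
Proof.
move=> HH iH jH ij; apply: contrapT => H1.
have all1 u : u \in hstab rW H -> chi u ^ (i%:Z - j%:Z) = 1.
  by move=> uH; apply: contrapT => /eqP uij; apply: H1; exists u.
pose m := (maxn i j - minn i j)%N.
have m0 : (0 < m)%N by rewrite /m; move: ij; case: (ltngtP i j) => //; lia.
have mH : (m < hord rW H)%N by rewrite /m; lia.
have allm u : u \in hstab rW H -> chi u ^+ m = 1.
  move=> uH; have d0 := det_repr_neq0 rW u.
  have E : chi u ^+ i = chi u ^+ j.
    by rewrite -[LHS]/(chi u ^ i%:Z) -(subrK j%:Z i%:Z) expfzDr // all1 // mul1r.
  rewrite /m; case/orP: (leq_total i j) => lij.
    rewrite (maxn_idPr lij) (minn_idPl lij).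
    by apply: (mulfI (expf_neq0 i d0)); rewrite -exprD mulr1 subnKC.
  rewrite (maxn_idPl lij) (minn_idPr lij).
  by apply: (mulfI (expf_neq0 j d0)); rewrite -exprD mulr1 subnKC.
(* The n_H elements of W_H have distinct determinants, and these cannot all be roots of X^m - 1 with
   0 < m < n_H. *)
suff : (hord rW H <= m)%N by rewrite leqNgt mH.
have -> : hord rW H = size [seq \det (rW u) | u <- enum (hstab rW H)].
  by rewrite size_map -cardE.
apply: max_unity_roots => //.
  apply/allP => _ /mapP[u uH ->]; apply/unity_rootP; apply: allm.
  by rewrite mem_enum in uH.
rewrite map_inj_in_uniq ?enum_uniq // => u w; rewrite !mem_enum => uH wH uw.
apply/eqP; rewrite eq_mulgV1; apply/eqP.
apply: (det_hstab_eq1 rW_faithful alpha_ker HH); first by rewrite hstab_mulr ?hstabV.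
by rewrite detM detV uw divff ?det_repr_neq0.
Qed.

(** Choose u in W_H with det(u)^(i-j) <> 1. On the projection p one has u p - p = (det(u)^(i-j) - 1)
    p, while u acts trivially modulo alpha_H. *)
Lemma divides_gact_neq H (i j : nat) f : H \in hyperplanes rW ->
  (i < hord rW H)%N -> (j < hord rW H)%N -> i != j ->
  divides (lform H) (Defs.gact rW (idem_H rW H (i%:Z - j%:Z)) f).
Proof.
move=> HH iH jH ij; have [u uH u1] := exists_character_neq1 HH iH jH ij.
have := polact_congr alpha_ker (Defs.gact rW (idem_H rW H (i%:Z - j%:Z)) f) HH uH.
rewrite polact_gact_idem // -{2}[Defs.gact _ _ _]scale1r -scalerBl.
move=> /(divides_mull (((chi u ^ (i%:Z - j%:Z) - 1)^-1)%:MP)).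
by rewrite mul_mpolyC scalerA mulVf ?scale1r // subr_eq0.
Qed.

Lemma divides_scale (c : C) f g : divides f g -> divides f (c *: g).
Proof. by rewrite -mul_mpolyC; apply: divides_mull. Qed.

Lemma divides_gact_idem H l m f : H \in hyperplanes rW ->
  divides (lform H ^+ m) f -> divides (lform H ^+ m) (Defs.gact rW (idem_H rW H l) f).
Proof.
move=> HH [g ->]; apply: divides_sum => u _.
have [uH|uH] := boolP (u \in hstab rW H); last first.
  by rewrite idem_H_out // scale0r; apply: divides0.
apply: divides_scale; rewrite polact_mul polact_exp.
rewrite (polact_alpha_hstab alpha_ker HH uH) exprZn.
exact/divides_mull/divides_scale/dividesxx.
Qed.

(** The exponent is a multiple of n_H, so the power of alpha_H is W_H-invariant. *)
Lemma gact_mul_alpha H l m f : H \in hyperplanes rW ->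
  Defs.gact rW (idem_H rW H l) (f * lform H ^+ (hord rW H * m)) =
  Defs.gact rW (idem_H rW H l) f * lform H ^+ (hord rW H * m).
Proof.
move=> HH; rewrite /Defs.gact mulr_suml; apply: eq_bigr => u _.
have [uH|uH] := boolP (u \in hstab rW H); last by rewrite idem_H_out // !scale0r mul0r.
rewrite polact_mul polact_exp (polact_alpha_hstab alpha_ker HH uH) exprZn.
by rewrite exprM exprVn det_hstab_order // invr1 expr1n scale1r scalerAl.
Qed.

(** The difference is the mean of f - u f over W_H. *)
Lemma divides_sub_gact0 H f : H \in hyperplanes rW ->
  divides (lform H) (f - Defs.gact rW (idem_H rW H 0) f).
Proof.
move=> HH; have fE : f = \sum_(u in hstab rW H) (hord rW H)%:R^-1 *: f.
  by rewrite sumr_const -/(hord rW H) -scaler_nat scalerA mulfV ?hordC_neq0 ?scale1r.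
rewrite {1}fE /Defs.gact big_mkcond -sumrB; apply: divides_sum => u _.
case: ifP => uH; last by rewrite idem_H_out ?uH // scale0r subrr; apply: divides0.
rewrite idem_H_in // oppr0 expr0z mulr1 -scalerBr; apply: divides_scale.
by rewrite -opprB; apply/divides_opp/polact_congr.
Qed.

Lemma rproj_residue H (j : nat) F v :
  rproj H j%:Z (residue H F) v =
  \sum_(i < hord rW H) (hord rW H * k H i)%:R *:
    Defs.gact rW (idem_H rW H (i%:Z - j%:Z)) (rproj H j%:Z F v).
Proof.
rewrite /rproj /residue /Defs.gact.
transitivity (\sum_(u : W) \sum_(i < hord rW H) (hord rW H * k H i)%:R *:
    \sum_(w : W) (idem_H rW H j%:Z u * idem_H rW H i%:Z w) *: translate w F (u^-1 * v)%g).
  apply: eq_bigr => u _; rewrite scaler_sumr; apply: eq_bigr => i _.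
  rewrite scalerA mulrC -scalerA; congr (_ *: _); rewrite scaler_sumr.
  by apply: eq_bigr => w _; rewrite scalerA.
rewrite exchange_big /=; apply: eq_bigr => i _; rewrite -scaler_sumr; congr (_ *: _).
rewrite exchange_big /=; apply: eq_bigr => w _.
rewrite polact_sum [RHS]scaler_sumr.
(* With u = t w^-1 the translation by w drops out of the group argument of [F]. *)
rewrite [LHS](reindex_inj (mulIg w^-1%g)) /=.
apply: eq_bigr => t _; rewrite polactZ scalerA idem_H_mul /translate.
by congr (_ *: polact _ _ (F _)); rewrite invMg invgK !mulgA mulVg mul1g.
Qed.

Lemma sum_rproj H F v : H \in hyperplanes rW ->
  \sum_(j < hord rW H) rproj H j%:Z F v = F v.
Proof.
move=> HH; rewrite /rproj exchange_big /= (bigD1 1%g) //= -scaler_suml.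
rewrite sum_idem_H // eqxx scale1r invg1 mul1g big1 ?addr0 // => u u1.
by rewrite -scaler_suml sum_idem_H // (negbTE u1) scale0r.
Qed.

Lemma divides_residue H F v : H \in hyperplanes rW -> vector_quasi_invariant F ->
  divides (lform H) (residue H F v).
Proof.
move=> HH qF; rewrite -(sum_rproj (residue H F) v HH); apply: divides_sum => j _.
rewrite rproj_residue; apply: divides_sum => i _.
have [ij|ij] := eqVneq (i : nat) j; last first.
  by apply/divides_scale/divides_gact_neq.
rewrite ij subrr.
(* For i = j the quasi-invariance itself supplies a power of alpha_H, with positive exponent unless
   the coefficient is 0. *)
have [->|kj] := eqVneq (k H j) 0%N; first by rewrite muln0 scale0r; apply: divides0.
apply: divides_scale; have /(divides_gact_idem 0 HH) := qF H HH j (ltn_ord j) v.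
apply: divides_trans; rewrite -{1}[lform H]expr1; apply: divides_exp_le.
by rewrite muln_gt0 hord_gt0 lt0n kj.
Qed.

Lemma rproj_sum H j (I : Type) (r : seq I) (c : I -> C) (F : I -> W -> CV) v :
  rproj H j (fun v => \sum_(i <- r) c i *: F i v) v =
  \sum_(i <- r) c i *: rproj H j (F i) v.
Proof.
rewrite /rproj; under eq_bigr => u _ do rewrite scaler_sumr.
rewrite exchange_big /=; apply: eq_bigr => i _; rewrite scaler_sumr.
by apply: eq_bigr => u _; rewrite !scalerA mulrC.
Qed.

Lemma vqi_sum (I : Type) (r : seq I) (c : I -> C) (F : I -> W -> CV) :
  (forall i, vector_quasi_invariant (F i)) ->
  vector_quasi_invariant (fun v => \sum_(i <- r) c i *: F i v).
Proof.
move=> qF H HH j jH v; rewrite rproj_sum; apply: divides_sum => i _.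
exact/divides_scale/qF.
Qed.

Lemma vqi_add F G : vector_quasi_invariant F -> vector_quasi_invariant G ->
  vector_quasi_invariant (fun v => F v + G v).
Proof.
move=> qF qG H HH j jH v; rewrite /rproj.
under eq_bigr => u _ do rewrite scalerDr.
by rewrite big_split; apply: divides_add; [apply: qF | apply: qG].
Qed.

Lemma vqi_mul (p : CV) F : vector_quasi_invariant F ->
  vector_quasi_invariant (fun v => p * F v).
Proof.
move=> qF H HH j jH v; rewrite /rproj.
under eq_bigr => u _ do rewrite scalerAr.
by rewrite -mulr_sumr; apply/divides_mull/qF.
Qed.

Hypothesis k_invariant : forall (w : W) H, H \in hyperplanes rW ->
  forall i, (i < hord rW H)%N -> k (lact rW w @: H)%VS i = k H i.

Lemma idem_H_lact w H l u :
  idem_H rW (lact rW w @: H)%VS l u = idem_H rW H l (w^-1 * u * w)%g.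
Proof.
rewrite /idem_H hord_lact hstab_lact; congr (if _ then _ * _ ^ _ else _).
by rewrite !detM detV mulrC mulrA divff ?det_repr_neq0 ?mul1r.
Qed.

(** The condition at w^-1 H is carried to H, w taking one linear form to a multiple of the other.
    Asking for it at one group argument only lets [quasi_invariantP] spread it from the identity to
    all v. *)
Lemma rproj_translate w F v :
  (forall H, H \in hyperplanes rW -> forall j, (j < hord rW H)%N ->
     divides (lform H ^+ (hord rW H * k H j)) (rproj H j%:Z F (w^-1 * v)%g)) ->
  forall H, H \in hyperplanes rW -> forall j, (j < hord rW H)%N ->
    divides (lform H ^+ (hord rW H * k H j)) (rproj H j%:Z (translate w F) v).
Proof.
move=> qF H HH j jH; pose H' := (lact rW w^-1%g @: H)%VS.
have HH' : H' \in hyperplanes rW by apply: hyperplane_lact.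
have HE : H = (lact rW w @: H')%VS by rewrite /H' lact_lact mulgV lact1.
have jH' : (j < hord rW H')%N by rewrite /H' hord_lact.
have kE : k H j = k H' j by rewrite HE k_invariant.
have -> : rproj H j%:Z (translate w F) v = polact rW w (rproj H' j%:Z F (w^-1 * v)%g).
  rewrite /rproj polact_sum (reindex_inj (conjg_inj w^-1%g)) /=.
  apply: eq_bigr => u _; rewrite polactZ /translate HE idem_H_lact.
  have -> : (w^-1 * u ^ w^-1 * w = u)%g by rewrite conjgE invgK !mulgA mulVg mul1g mulgKV.
  congr (_ *: polact _ _ (F _)).
  by rewrite conjgE !invMg !invgK !mulgA mulVg mul1g.
have [g ->] := qF H' HH' j jH'.
have [c c0 cE] := polact_alpha alpha_ker w HH'.
rewrite polact_mul polact_exp cE -HE exprZn kE.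
have -> : hord rW H' = hord rW H by rewrite /H' hord_lact.
exact/divides_mull/divides_scale/dividesxx.
Qed.

Lemma vqi_translate w F : vector_quasi_invariant F ->
  vector_quasi_invariant (translate w F).
Proof.
move=> qF H HH j jH v; apply: rproj_translate => // H' HH' j' jH'; exact: qF.
Qed.

Lemma vqi_residue H F : vector_quasi_invariant F -> vector_quasi_invariant (residue H F).
Proof.
move=> qF; apply: vqi_sum => i; apply: vqi_sum => w; exact: vqi_translate.
Qed.

Lemma dirderiv_linform (xi : 'cV[C]_n) a : dirderiv xi (linform a) = (a xi)%:MP.
Proof.
rewrite /linform (raddf_sum (dirderiv xi)) /= [in RHS](matrix_sum_delta xi).
rewrite linear_sum rmorph_sum /=; apply: eq_bigr => i _.
rewrite -mul_mpolyC dirderivM dirderivC mul0r add0r dirderivX big_ord1.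
by rewrite linearZ /= -mpolyCM mulrC.
Qed.

(** The extra factor [linform a] avoids the exponent m - 1. *)
Lemma linform_dirderiv_exp xi a m :
  linform a * dirderiv xi (linform a ^+ m) = (a xi * m%:R)%:MP * linform a ^+ m :> CV.
Proof.
elim: m => [|m IH].
  by rewrite expr0 -mpolyC1 dirderivC !mulr0 mpolyC0 mul0r.
rewrite exprS dirderivM mulrDr [linform a * (linform a * _)]mulrCA IH.
rewrite dirderiv_linform -natr1 mulrDr mulr1 mpolyCD; ring.
Qed.

Lemma dirderiv_rproj xi H j F v :
  rproj H j (fun v => dirderiv xi (F v)) v = dirderiv xi (rproj H j F v).
Proof.
rewrite /rproj (raddf_sum (dirderiv xi)) /=; apply: eq_bigr => u _.
by rewrite -!mul_mpolyC dirderivM dirderivC mul0r add0r.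
Qed.

Lemma sum_gact_mul_alpha H (c : nat -> C) (j m : nat) g : H \in hyperplanes rW ->
  \sum_(i < hord rW H) c i *:
    Defs.gact rW (idem_H rW H (i%:Z - j%:Z)) (g * lform H ^+ (hord rW H * m)) =
  (\sum_(i < hord rW H) c i *: Defs.gact rW (idem_H rW H (i%:Z - j%:Z)) g) *
    lform H ^+ (hord rW H * m).
Proof.
move=> HH; rewrite mulr_suml; apply: eq_bigr => i _.
by rewrite gact_mul_alpha //; apply: scalerAl.
Qed.

(** [S] supplies the quotients of the residues by the alpha_H, so that the Dunkl operator is
    expressed on polynomials without division. *)
Lemma vqi_dunkl (xi : 'cV[C]_n) F (S : {vspace 'cV[C]_n} -> W -> CV) :
  vector_quasi_invariant F ->
  (forall H, H \in hyperplanes rW -> forall v, residue H F v = S H v * lform H) ->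
  vector_quasi_invariant (fun v => dirderiv xi (F v) -
    \sum_(H <- hyperplanes rW) alpha H xi *: S H v).
Proof.
move=> qF SE H HH j jH v.
have rprojS H' : H' \in hyperplanes rW ->
    rproj H j%:Z (residue H' F) v = rproj H j%:Z (S H') v * lform H'.
  move=> HH'; rewrite /rproj mulr_suml; apply: eq_bigr => u _.
  by rewrite SE // scalerAl.
have -> : rproj H j%:Z (fun v => dirderiv xi (F v) -
    \sum_(H' <- hyperplanes rW) alpha H' xi *: S H' v) v =
  dirderiv xi (rproj H j%:Z F v) -
    \sum_(H' <- hyperplanes rW) alpha H' xi *: rproj H j%:Z (S H') v.
  rewrite -dirderiv_rproj -rproj_sum /rproj -sumrB.
  by apply: eq_bigr => u _; rewrite scalerBr.
rewrite (bigD1_seq H) ?undup_uniq //= opprD addrA.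
(* Another hyperplane H' contributes a term whose product with alpha_{H'} is a residue, which
   satisfies the condition at H; alpha_H is prime and does not divide alpha_{H'}. *)
apply: divides_sub; last first.
  rewrite big_seq_cond; apply: divides_sum => H' /andP[HH' H'H].
  apply: divides_scale.
  have pH := linform_prime (alpha_neq0 alpha_ker HH).
  apply: (prime_elt_Gauss pH (b := lform H')).
    by apply: (linform_alpha_Ndivides alpha_ker) => //; rewrite eq_sym.
  by rewrite mulrC -rprojS //; apply: vqi_residue.
have [g gE] := qF H HH j jH v.
have a0 : lform H != 0 by apply: linform_alpha_neq0 HH.
pose sumg := \sum_(i < hord rW H) (hord rW H * k H i)%:R *:
  Defs.gact rW (idem_H rW H (i%:Z - j%:Z)) g.
(* Multiplied by alpha_H, the terms at H show the full required power; one more alpha_H must come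
   from the bracket. *)
have key : (dirderiv xi (rproj H j%:Z F v) - alpha H xi *: rproj H j%:Z (S H) v) * lform H =
    (lform H * dirderiv xi g + (alpha H xi)%:MP *
       ((hord rW H * k H j)%:R%:MP * g - sumg)) * lform H ^+ (hord rW H * k H j).
  rewrite mulrBl -scalerAl -rprojS // rproj_residue gE.
  rewrite [in LHS](sum_gact_mul_alpha (fun i => (hord rW H * k H i)%:R) j (k H j) g HH).
  rewrite -/sumg -[_ *: _]mul_mpolyC dirderivM; apply: derivation_exp_identity.
  by rewrite linform_dirderiv_exp mpolyCM.
have [h hE] : divides (lform H) (lform H * dirderiv xi g + (alpha H xi)%:MP *
    ((hord rW H * k H j)%:R%:MP * g - sumg)).
  apply: divides_add; first exact/divides_mulr/dividesxx.
  apply: divides_mull; rewrite mul_mpolyC.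
  (* The term i = j cancels n_H k_{H,j} g up to a multiple of g - e_{H,0} g; the terms i <> j vanish
     on H. *)
  rewrite /sumg (bigD1 (Ordinal jH)) //= subrr opprD addrA.
  apply: divides_sub.
    by rewrite -scalerBr; apply/divides_scale/divides_sub_gact0.
  by apply: divides_sum => i ij; apply/divides_scale/divides_gact_neq.
by exists h; apply: (mulIf a0); rewrite key hE mulrAC.
Qed.

(** Left translation by u turns into the action of u^-1 on f, which negates the index: this is why
    Q_k is defined with e_{H,-i}. *)
Lemma rproj_polact H j f v :
  rproj H j (fun v => polact rW v f) v = Defs.gact rW (idem_H rW H (- j)) (polact rW v f).
Proof.
rewrite /rproj /Defs.gact [LHS](reindex_inj invg_inj) /=; apply: eq_bigr => u _.
rewrite invgK polactM; congr (_ *: _).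
rewrite /idem_H hstabV detV opprK; case: ifP => // _.
by rewrite exprz_inv opprK.
Qed.

(** f corresponds to the W-invariant element sum_v (v f) (x) v, for which the condition at v = 1
    implies all the others. *)
Lemma quasi_invariantP f :
  quasi_invariant rW alpha k f <-> vector_quasi_invariant (fun v => polact rW v f).
Proof.
split=> [qf H HH j jH v|qf H HH j jH]; last first.
  by have := qf H HH j jH 1%g; rewrite rproj_polact polact1.
have [|g gE] := @rproj_translate v (fun v => polact rW v f) v _ H HH j jH.
  by move=> H' HH' j' jH'; rewrite mulVg rproj_polact polact1; apply: qf.
exists g; apply: etrans gE; apply: eq_bigr => u _; congr (_ *: _).
by rewrite /translate -polactM mulKVg.
Qed.

Lemma quasi_invariant_alpha N f :
  (forall H, H \in hyperplanes rW -> forall i, (i < hord rW H)%N ->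
     (hord rW H * k H i <= N)%N) ->
  quasi_invariant rW alpha k ((\prod_(H <- hyperplanes rW) lform H) ^+ N * f).
Proof.
move=> HN H HH i iH; apply: divides_gact_idem => //; apply: divides_mulr.
apply: divides_trans (divides_exp_le _ (HN H HH i iH)) _.
by apply: divides_exp; rewrite -(big_map (fun H => lform H) xpredT id);
   apply/divides_prod/map_f.
Qed.

End QuasiInvariants.

(** * The crossed product, its action and averaging *)

Section CrossedProduct.

Variables (C : fieldType) (n : nat) (W : finGroupType).
Variable rW : mx_representation C [set: W]%G n.
Local Notation CV := {mpoly C[n]}.
Local Notation KV := {fraction CV}.
Local Notation crossed := (W -> KV -> KV).
Implicit Types (a b : crossed) (D : KV -> KV) (phi : W -> KV).

Lemma cmulE a b w x :
  cmul rW a b w x = \sum_(u : W) a u (conjop rW u (b (u^-1 * w)%g) x).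
Proof.
rewrite /cmul; by elim/big_rec2: _ => // u y f _ <-.
Qed.

Lemma conjopE w D x : conjop rW w D x = ratact rW w (D (ratact rW w^-1 x)).
Proof. by []. Qed.

Lemma conjop1 D x : conjop rW 1%g D x = D x.
Proof. by rewrite conjopE invg1 2!ratact1. Qed.

Lemma conjopM u w D x : conjop rW u (conjop rW w D) x = conjop rW (u * w)%g D x.
Proof. by rewrite !conjopE invMg 2!ratactM. Qed.

Lemma conjop_mulop_const w c x : conjop rW w (mulop (constK n c)) x = constK n c * x.
Proof. by rewrite conjopE /mulop ratact_mul ratact_const ratactKV. Qed.

Lemma copE D (w : W) x : cop D w x = if w == 1%g then D x else 0.
Proof. by rewrite /cop; case: (w == 1%g). Qed.

Lemma cmul_copE D b w x : (D 0 = 0) -> cmul rW (cop D) b w x = D (b w x).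
Proof.
move=> D0; rewrite cmulE (bigD1 1%g) //= copE eqxx conjop1 invg1 mul1g.
by rewrite big1 ?addr0 // => u /negbTE u1; rewrite copE u1.
Qed.

Lemma cmul_cgrpr a c w x : (forall u, Clinear (a u)) ->
  cmul rW a (cgrp c) w x = \sum_(u : W) constK n (c (u^-1 * w)%g) * a u x.
Proof.
move=> la; rewrite cmulE; apply: eq_bigr => u _.
by rewrite conjop_mulop_const (ClinearZ (la u)).
Qed.

(* The action of D(C(V)) * W on C(V) (x) CW, where W acts diagonally. *)
Definition cact a phi : W -> KV :=
  fun v => \sum_(w : W) a w (ratact rW w (phi (w^-1 * v)%g)).

Lemma cact_cmul a b phi v : (forall u, Clinear (a u)) ->
  cact (cmul rW a b) phi v = cact a (cact b phi) v.
Proof.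
move=> la; rewrite /cact.
under eq_bigr => w _ do rewrite cmulE.
rewrite exchange_big /=; apply: eq_bigr => u _.
rewrite ratact_sum (Clinear_sum (la u)) [LHS](reindex_inj (mulgI u)) /=.
apply: eq_bigr => w _; by rewrite conjopE -ratactM !mulKg invMg mulgA.
Qed.

(** The operator D with a e = D e, since w e = e. *)
Definition total a : KV -> KV := fun x => \sum_(w : W) a w x.

(** The operator E with e D e = E e, since w D e = (w D w^-1) e. *)
Definition average D : KV -> KV :=
  fun x => constK n (#|W|%:R^-1) * \sum_(w : W) conjop rW w D x.

Lemma average_conjop w D : conjop rW w (average D) = average D.
Proof.
apply: funext => x; rewrite conjopE /average ratact_mul ratact_const ratact_sum.
apply: congr1; rewrite [RHS](reindex_inj (mulgI w)).
apply: eq_bigr => u _.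
exact: conjopM.
Qed.

End CrossedProduct.

(** * The Cherednik algebra acting on vector-valued quasi-invariants *)

Section Cherednik.

Variables (C : numFieldType) (n : nat) (W : finGroupType).
Variable rW : mx_representation C [set: W]%G n.
Hypothesis rW_faithful : mx_faithful rW.
Variable alpha : {vspace 'cV[C]_n} -> 'Hom('cV[C]_n, C^o).
Hypothesis alpha_ker : forall H, H \in hyperplanes rW -> lker (alpha H) = H.
Variable k : {vspace 'cV[C]_n} -> nat -> nat.
Hypothesis k_invariant : forall (w : W) H, H \in hyperplanes rW ->
  forall i, (i < hord rW H)%N -> k (lact rW w @: H)%VS i = k H i.
Local Notation CV := {mpoly C[n]}.
Local Notation KV := {fraction CV}.
Local Notation lform H := (linform (alpha H)).
Local Notation crossed := (W -> KV -> KV).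
Local Notation delta := (\prod_(H <- hyperplanes rW) lform H).
Local Notation Vreg := (Vreg_functions rW alpha).
Implicit Types (a b h : crossed) (D E : KV -> KV).

Lemma delta_neq0 : delta != 0.
Proof.
rewrite prodf_seq_neq0; apply/allP => H HH; rewrite implyTb.
exact: (linform_alpha_neq0 alpha_ker).
Qed.

Lemma deltaX_neq0 m : (delta ^+ m)%:F != 0 :> KV.
Proof. by rewrite tofrac_eq0 expf_neq0 // delta_neq0. Qed.

Lemma Vreg_poly (p : CV) : Vreg p%:F.
Proof. by exists p, 0%N; rewrite expr0 tofrac1 divr1. Qed.

Lemma Vreg_add x y : Vreg x -> Vreg y -> Vreg (x + y).
Proof.
move=> [p [m ->]] [q [l ->]].
exists (p * delta ^+ l + q * delta ^+ m), (m + l)%N.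
by rewrite addf_div ?deltaX_neq0 // exprD tofracD !tofracM.
Qed.

Lemma Vreg_mul x y : Vreg x -> Vreg y -> Vreg (x * y).
Proof.
move=> [p [m ->]] [q [l ->]]; exists (p * q), (m + l)%N.
by rewrite mulf_div exprD !tofracM.
Qed.

Lemma Vreg_sum I (r : seq I) (P : pred I) (F : I -> KV) :
  (forall i, P i -> Vreg (F i)) -> Vreg (\sum_(i <- r | P i) F i).
Proof.
move=> VF; apply: (@big_ind _ Vreg) VF; last exact: Vreg_add.
by rewrite -tofrac0; apply: Vreg_poly.
Qed.

Lemma Vreg_const c : Vreg (constK n c).
Proof. exact: Vreg_poly. Qed.

Lemma Vreg_alphaV H : H \in hyperplanes rW -> Vreg (lform H)%:F^-1.
Proof.
move=> HH; have [g gE] : divides (lform H) delta.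
  by rewrite -(big_map (fun H => lform H) xpredT id); apply/divides_prod/map_f.
have g0 : g%:F != 0 :> KV.
  rewrite tofrac_eq0; apply: contraTneq delta_neq0 => g0.
  by rewrite gE g0 mul0r eqxx.
by exists g, 1%N; rewrite expr1 gE tofracM invfM mulrA mulfV // mul1r.
Qed.

Lemma Vreg_ratact w x : Vreg x -> Vreg (ratact rW w x).
Proof.
move=> [p [m ->]]; have d0 : delta ^+ m != 0 by rewrite expf_neq0 // delta_neq0.
rewrite (ratact_frac rW w p d0); apply: Vreg_mul; first exact: Vreg_poly.
rewrite polact_exp tofracXn -exprVn.
have VX y : Vreg y -> Vreg (y ^+ m).
  move=> Vy; elim: m {d0} => [|m IH]; last by rewrite exprS; apply: Vreg_mul.
  by rewrite expr0 -tofrac1; apply: Vreg_poly.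
(* The product is generalised to a sublist; the inclusion keeps every factor a form of a reflection
   hyperplane. *)
apply: VX; have : {subset hyperplanes rW <= hyperplanes rW} by [].
elim: {1 3}(hyperplanes rW) => [_|H s IH sH].
  by rewrite big_nil (rmorph1 (polact rW w)) tofrac1 invr1 -tofrac1; apply: Vreg_poly.
rewrite big_cons polact_mul tofracM invfM; apply: Vreg_mul; last first.
  by apply: IH => H' sH'; apply: sH; rewrite inE sH' orbT.
have HH := sH H (mem_head _ _); have [c c0 ->] := polact_alpha alpha_ker w HH.
rewrite -mul_mpolyC tofracM invfM; apply: Vreg_mul; last first.
  exact/Vreg_alphaV/hyperplane_lact.
by rewrite -/(constK n c) -fmorphV; apply: Vreg_const.
Qed.

Lemma Vreg_dirderivK xi x : Vreg x -> Vreg (dirderivK xi x).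
Proof.
move=> [p [m ->]]; have d0 : delta ^+ m != 0 by rewrite expf_neq0 // delta_neq0.
rewrite (dirderivK_frac xi p d0).
by exists (dirderiv xi p * delta ^+ m - p * dirderiv xi (delta ^+ m)), (m * 2)%N;
   rewrite exprM.
Qed.

Definition dunkl_coef (xi : 'cV[C]_n) (w : W) : KV :=
  \sum_(H <- hyperplanes rW) constK n (alpha H xi) / (lform H)%:F *
    constK n (\sum_(i < hord rW H) (hord rW H * k H i)%:R * idem_H rW H i w).

Lemma dunklE xi w x : dunkl rW alpha k xi w x =
  (if w == 1%g then dirderivK xi x else 0) - dunkl_coef xi w * x.
Proof.
rewrite /dunkl -copE; congr (_ - _).
rewrite /dunkl_coef mulr_suml; elim/big_rec2: _ => // H y f _ <-.
congr (_ + _); rewrite cmul_copE; last by rewrite /mulop mulr0.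
by rewrite /cgrp /mulop mulrA.
Qed.

Lemma Vreg_dunkl_coef xi w : Vreg (dunkl_coef xi w).
Proof.
rewrite /dunkl_coef big_seq; apply: Vreg_sum => H HH.
by apply: Vreg_mul (Vreg_const _); apply: Vreg_mul (Vreg_const _) (Vreg_alphaV HH).
Qed.

(** An invariant for induction over H_k: it holds for the generators and survives the algebra
    operations. The third clause places averages in D(Vreg), the last one makes the vector-valued
    quasi-invariants a module. *)
Definition admissible a : Prop :=
  [/\ forall w, Clinear (a w), exists m, forall w, diffop_lt m (a w),
      forall w x, Vreg x -> Vreg (a w x)
    & forall F, vector_quasi_invariant rW alpha k F ->
        exists2 G, vector_quasi_invariant rW alpha k G
          & forall v, cact rW a (fun v => (F v)%:F) v = (G v)%:F].

Lemma cact_ext a phi psi v : (forall v, phi v = psi v) ->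
  cact rW a phi v = cact rW a psi v.
Proof. by move=> E; apply: eq_bigr => w _; rewrite E. Qed.

Lemma cact_cop D (phi : W -> KV) v : cact rW (cop D) phi v = D (phi v).
Proof.
rewrite /cact (bigD1 1%g) //= copE eqxx ratact1 invg1 mul1g.
by rewrite big1 ?addr0 // => w /negbTE w1; rewrite copE w1.
Qed.

Lemma cact_cgrp c (F : W -> CV) v :
  cact rW (cgrp c) (fun v => (F v)%:F) v = (\sum_(w : W) c w *: translate rW w F v)%:F.
Proof.
rewrite /cact (raddf_sum (@FracField.tofrac CV)); apply: eq_bigr => w _ /=.
by rewrite /cgrp /mulop ratact_tofrac -mul_mpolyC tofracM.
Qed.

Lemma Clinear_cmul a b : (forall w, Clinear (a w)) -> (forall w, Clinear (b w)) ->
  forall w, Clinear (cmul rW a b w).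
Proof.
move=> la lb w c x y; rewrite !cmulE mulr_sumr -big_split; apply: eq_bigr => u _ /=.
by rewrite (Clinear_conjop rW u (lb _)) la.
Qed.

Lemma admissible_subalgebra : subalgebra rW admissible.
Proof.
split.
- split.
  + move=> w; rewrite /cop; case: (w == 1%g); first exact: Clinear_id.
    exact: Clinear_zero.
  + exists 1%N => w; rewrite /cop; case: (w == 1%g).
      apply: eq_diffop_lt (@diffop_lt_mulop C n 1) => x.
      by rewrite /mulop mul1r.
    exact: diffop_lt_zero.
  + move=> w x Vx; rewrite copE; case: (w == 1%g) => //.
    by rewrite -tofrac0; apply: Vreg_poly.
  + by move=> F qF; exists F => // v; rewrite cact_cop.
- move=> a b [la [ma oa] Va qa] [lb [mb ob] Vb qb]; split.
  + by move=> w; apply: Clinear_add (la w) (lb w).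
  + exists (maxn ma mb) => w; apply: diffop_lt_add.
      by apply: diffop_lt_le (oa w); rewrite leq_maxl.
    by apply: diffop_lt_le (ob w); rewrite leq_maxr.
  + by move=> w x Vx; apply: Vreg_add; [apply: Va | apply: Vb].
  + move=> F qF; have [G1 q1 E1] := qa F qF; have [G2 q2 E2] := qb F qF.
    exists (fun v => G1 v + G2 v); first exact: vqi_add.
    by move=> v; rewrite tofracD -E1 -E2 /cact -big_split.
- move=> c a [la [m oa] Va qa]; split.
  + by move=> w; apply: (Clinear_comp (Clinear_mulop (constK n c)) (la w)).
  + by exists m => w; apply: diffop_lt_mull.
  + by move=> w x Vx; apply: Vreg_mul (Vreg_const _) (Va _ _ Vx).
  + move=> F qF; have [G q E] := qa F qF.
    exists (fun v => c%:MP * G v); first exact: vqi_mul.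
    by move=> v; rewrite tofracM -E /cact mulr_sumr.
- move=> a b [la [ma oa] Va qa] [lb [mb ob] Vb qb].
  split.
  + exact: Clinear_cmul.
  + exists (ma + mb).-1 => w.
    apply: (@eq_diffop_lt _ _ _ (fun x => \sum_(u : W) a u (conjop rW u (b (u^-1 * w)%g) x))).
      by move=> x; rewrite cmulE.
    apply: diffop_lt_sum => u.
    exact: diffop_lt_comp (la u) (oa u) (diffop_lt_conjop rW u (ob _)).
  + move=> w x Vx; rewrite cmulE; apply: Vreg_sum => u _; apply/Va/Vreg_ratact/Vb.
    exact: Vreg_ratact.
  + move=> F qF; have [G1 q1 E1] := qb F qF; have [G2 q2 E2] := qa G1 q1.
    exists G2 => // v; rewrite cact_cmul // -E2.
    exact: cact_ext.
Qed.

Lemma admissible_mul (p : CV) : admissible (cop (mulop p%:F)).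
Proof.
split.
- move=> w; rewrite /cop; case: (w == 1%g); first exact: Clinear_mulop.
  exact: Clinear_zero.
- exists 1%N => w; rewrite /cop; case: (w == 1%g); first exact: diffop_lt_mulop.
  exact: diffop_lt_zero.
- move=> w x Vx; rewrite copE; case: (w == 1%g).
    exact: Vreg_mul (Vreg_poly _) Vx.
  by rewrite -tofrac0; apply: Vreg_poly.
- move=> F qF; exists (fun v => p * F v); first exact: vqi_mul.
  by move=> v; rewrite cact_cop tofracM.
Qed.

Lemma admissible_cgrp c : admissible (cgrp c).
Proof.
split.
- by move=> w; apply: Clinear_mulop.
- by exists 1%N => w; apply: diffop_lt_mulop.
- by move=> w x Vx; apply: Vreg_mul (Vreg_const _) Vx.
- move=> F qF; exists (fun v => \sum_(w : W) c w *: translate rW w F v).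
    by apply: vqi_sum => w; apply: vqi_translate.
  by move=> v; rewrite cact_cgrp.
Qed.

Lemma Clinear_dunkl xi w : Clinear (dunkl rW alpha k xi w).
Proof.
move=> c x y; rewrite !dunklE; case: (w == 1%g).
  by rewrite Clinear_dirderivK; ring.
by ring.
Qed.

Lemma cact_dunkl_coef xi (F : W -> CV) (S : {vspace 'cV[C]_n} -> W -> CV) v :
  (forall H, H \in hyperplanes rW -> forall v, residue rW k H F v = S H v * lform H) ->
  \sum_(w : W) dunkl_coef xi w * ratact rW w (F (w^-1 * v)%g)%:F =
  (\sum_(H <- hyperplanes rW) alpha H xi *: S H v)%:F.
Proof.
move=> SE.
transitivity (\sum_(w : W) \sum_(H <- hyperplanes rW)
  constK n (alpha H xi) / (lform H)%:F * (
    ((\sum_(i < hord rW H) (hord rW H * k H i)%:R * idem_H rW H i w) *: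
       translate rW w F v)%:F)).
  apply: eq_bigr => w _; rewrite /dunkl_coef mulr_suml; apply: eq_bigr => H _.
  by rewrite -[RHS]mulrA -[LHS]mulrA -mulrA -mul_mpolyC tofracM ratact_tofrac.
rewrite exchange_big (raddf_sum (@FracField.tofrac CV)) big_seq [RHS]big_seq /=.
apply: eq_bigr => H HH; rewrite -mulr_sumr -(raddf_sum (@FracField.tofrac CV)) /=.
have -> : \sum_(w : W) (\sum_(i < hord rW H) (hord rW H * k H i)%:R * idem_H rW H i w) *:
    translate rW w F v = S H v * lform H.
  rewrite -SE // /residue.
  transitivity (\sum_(w : W) \sum_(i < hord rW H) (hord rW H * k H i)%:R *:
    (idem_H rW H i w *: translate rW w F v)).
    apply: eq_bigr => w _; rewrite scaler_suml; apply: eq_bigr => i _.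
    by rewrite scalerA.
  by rewrite exchange_big; apply: eq_bigr => i _; rewrite scaler_sumr.
have a0 : (lform H)%:F != 0 :> KV.
  by rewrite tofrac_eq0 (linform_alpha_neq0 alpha_ker).
rewrite -mul_mpolyC !tofracM -mulrA; congr (_ * _).
by rewrite mulrC mulfK.
Qed.

Lemma admissible_dunkl xi : admissible (dunkl rW alpha k xi).
Proof.
split.
- exact: Clinear_dunkl.
- exists 2 => w.
  apply: (@eq_diffop_lt _ _ _ (fun x => cop (dirderivK xi) w x + mulop (- dunkl_coef xi w) x)).
    by move=> x; rewrite dunklE copE /mulop mulNr.
  apply: diffop_lt_add; last exact/diffop_ltS/diffop_lt_mulop.
  by rewrite /cop; case: (w == 1%g); [apply: diffop_lt_dirderivK | apply: diffop_lt_zero].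
- move=> w x Vx; rewrite dunklE -mulNr; apply: Vreg_add.
    case: (w == 1%g); first exact: Vreg_dirderivK.
    by rewrite -tofrac0; apply: Vreg_poly.
  apply: Vreg_mul Vx; rewrite -mulN1r -[-1](rmorphN1 (@constK C n)).
  exact: Vreg_mul (Vreg_const _) (Vreg_dunkl_coef _ _).
- move=> F qF.
  (* The quotients are chosen for all pairs at once, with default 0 away from the reflection
     hyperplanes. *)
  have exS (Hv : {vspace 'cV[C]_n} * W) : exists g : CV, Hv.1 \in hyperplanes rW ->
      residue rW k Hv.1 F Hv.2 = g * lform Hv.1.
    have [HH|] := boolP (Hv.1 \in hyperplanes rW); last by exists 0.
    have [g gE] := divides_residue rW_faithful alpha_ker Hv.2 HH qF.
    by exists g => _; rewrite gE.
  have [S SE] := choice exS.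
  have SE' H : H \in hyperplanes rW -> forall v, residue rW k H F v = S (H, v) * lform H.
    by move=> HH v; apply: (SE (H, v)).
  exists (fun v => dirderiv xi (F v) -
      \sum_(H <- hyperplanes rW) alpha H xi *: S (H, v)).
    exact: (@vqi_dunkl _ _ _ rW rW_faithful alpha alpha_ker k k_invariant xi F
      (fun H v => S (H, v))).
  move=> v; rewrite tofracB -dirderivK_tofrac.
  rewrite -(@cact_dunkl_coef xi F (fun H v => S (H, v))) // /cact.
  under eq_bigr => w _ do rewrite dunklE.
  rewrite sumrB; congr (_ - _).
  rewrite (bigD1 1%g) //= eqxx ratact1 invg1 mul1g big1 ?addr0 //.
  by move=> w /negbTE ->.
Qed.

Lemma cherednik_admissible h : cherednik rW alpha k h -> admissible h.
Proof.
move=> /(_ admissible admissible_subalgebra); apply.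
move=> _ [[[p _ <-]|[c _ <-]]|[xi _ <-]].
- exact: admissible_mul.
- exact: admissible_cgrp.
- exact: admissible_dunkl.
Qed.

Lemma cherednik_subalgebra : subalgebra rW (cherednik rW alpha k).
Proof.
split.
- by move=> S [S1 _ _ _] _.
- move=> a b ha hb S sS gS; have [_ Sa _ _] := sS.
  exact: Sa (ha S sS gS) (hb S sS gS).
- move=> c a ha S sS gS; have [_ _ Sc _] := sS.
  exact: Sc (ha S sS gS).
- move=> a b ha hb S sS gS; have [_ _ _ Sm] := sS.
  exact: Sm (ha S sS gS) (hb S sS gS).
Qed.

End Cherednik.

(** * The spherical subalgebra and D(Q_k)^W *)

Section SphericalSubalgebra.

Variables (C : numFieldType) (n : nat) (W : finGroupType).
Variable rW : mx_representation C [set: W]%G n.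
Hypothesis rW_faithful : mx_faithful rW.
Variable alpha : {vspace 'cV[C]_n} -> 'Hom('cV[C]_n, C^o).
Hypothesis alpha_ker : forall H, H \in hyperplanes rW -> lker (alpha H) = H.
Variable k : {vspace 'cV[C]_n} -> nat -> nat.
Hypothesis k_invariant : forall (w : W) H, H \in hyperplanes rW ->
  forall i, (i < hord rW H)%N -> k (lact rW w @: H)%VS i = k H i.
Local Notation CV := {mpoly C[n]}.
Local Notation KV := {fraction CV}.
Local Notation lform H := (linform (alpha H)).
Local Notation crossed := (W -> KV -> KV).
Local Notation delta := (\prod_(H <- hyperplanes rW) lform H).
Local Notation idW := (cgrp (@idem_W C W) : crossed).
Local Notation wt := (constK n (#|W|%:R^-1 : C)).
Local Notation dunkl := (dunkl rW alpha k).
Local Notation cherednik := (cherednik rW alpha k).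
Local Notation QI := (quasi_invariant rW alpha k).
Implicit Types (a b h : crossed) (D E : KV -> KV).

Lemma wt_neq0 : wt != 0.
Proof. by rewrite fmorph_eq0 invr_eq0 pnatr_eq0 -lt0n -cardsT cardG_gt0. Qed.

Lemma wt_sum (x : KV) : wt * \sum_(w : W) x = x.
Proof.
rewrite sumr_const -[x *+ _]mulr_natl mulrA -(rmorph_nat (@constK C n)) -rmorphM /=.
rewrite mulVf ?rmorph1 ?mul1r //.
by rewrite pnatr_eq0 -lt0n -cardsT cardG_gt0.
Qed.

Lemma Clinear_total a : (forall w, Clinear (a w)) -> Clinear (total a).
Proof.
move=> la c x y; rewrite /total mulr_sumr -big_split.
by apply: eq_bigr => w _; rewrite la.
Qed.

Lemma Clinear_average D : Clinear D -> Clinear (average rW D).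
Proof.
move=> lD; apply: (Clinear_comp (Clinear_mulop wt)) => c x y.
rewrite mulr_sumr -big_split; apply: eq_bigr => w _.
by rewrite (Clinear_conjop rW w lD).
Qed.

Lemma diffop_lt_average m D : diffop_lt m D -> diffop_lt m (average rW D).
Proof.
by move=> oD; apply/diffop_lt_mull/diffop_lt_sum => w; apply: diffop_lt_conjop.
Qed.

Lemma average_id D : (forall w, conjop rW w D = D) -> average rW D = D.
Proof.
move=> iD; apply: funext => x; rewrite /average.
by rewrite (eq_bigr (fun=> D x)) ?wt_sum // => w _; rewrite iD.
Qed.

Lemma average_sub D E x : average rW (fun x => D x - E x) x =
  average rW D x - average rW E x.
Proof.
rewrite /average -mulrBr -sumrB; congr (_ * _); apply: eq_bigr => w _.
by rewrite !conjopE ratact_sub.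
Qed.

(** By w e = e the product e h e is an operator times e, and all coefficients of e are 1/|W|. *)
Lemma sphericalE h w x : (forall u, Clinear (h u)) ->
  cmul rW idW (cmul rW h idW) w x = wt * average rW (total h) x.
Proof.
move=> lh; rewrite cmulE /average mulr_sumr mulr_sumr; apply: eq_bigr => u _.
rewrite -[LHS]/(wt * conjop rW u (cmul rW h idW (u^-1 * w)%g) x); congr (_ * _).
rewrite !conjopE cmul_cgrpr // /idem_W -mulr_sumr.
by rewrite ratact_mul ratact_const.
Qed.

Lemma spherical_copE D w x : Clinear D -> (forall u, conjop rW u D = D) ->
  cmul rW idW (cmul rW (cop D) idW) w x = wt * D x.
Proof.
move=> lD iD; rewrite sphericalE; last first.
  by move=> u; rewrite /cop; case: (u == 1%g); [|apply: Clinear_zero].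
rewrite (_ : total _ = D) ?average_id //; apply: funext => y.
rewrite /total (bigD1 1%g) //= copE eqxx big1 ?addr0 // => u /negbTE u1.
by rewrite copE u1.
Qed.

(** Every coefficient of e D e is D/|W|, so u determines D and the choice in [Res] is forced. *)
Lemma Res_eq (u : crossed) D : invops rW (DVreg rW alpha) D ->
  (forall w x, u w x = wt * D x) -> Res rW alpha u = D.
Proof.
move=> iD uE; apply: xget_subset1 => [|D1 D2 [[[[l1 _] _] i1] e1] [[[[l2 _] _] i2] e2]].
  split=> //; apply: funext => w; apply: funext => x; rewrite uE.
  by case: iD => [[[lD _] _] iD]; rewrite spherical_copE.
apply: funext => x; apply: (mulfI wt_neq0).
by rewrite -(spherical_copE 1%g x l1 i1) -(spherical_copE 1%g x l2 i2) e1 e2.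
Qed.

Lemma admissible_average_DVreg h : admissible rW alpha k h ->
  invops rW (DVreg rW alpha) (average rW (total h)).
Proof.
move=> [lh [m oh] Vh _]; split; last by move=> w; apply: average_conjop.
split; first split.
- exact/Clinear_average/Clinear_total.
- by exists m; apply/diffop_lt_average/diffop_lt_sum.
move=> x Vx; apply: (Vreg_mul (Vreg_const _ _ _)); apply: (Vreg_sum alpha_ker) => w _.
apply: (Vreg_ratact alpha_ker); apply: (Vreg_sum alpha_ker) => u _.
exact/Vh/(Vreg_ratact alpha_ker).
Qed.

(** Apply e h e to sum_v (v f) (x) v: its coefficient at v is D(v f) = v (D f), so the result has
    the same shape and D f lies in Q_k. *)
Lemma admissible_average_DQ h : admissible rW alpha k h ->
  invops rW (DQ rW alpha k) (average rW (total h)).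
Proof.
move=> Ah; have [lh [m oh] _ _] := Ah.
split; last by move=> w; apply: average_conjop.
split; first split.
- exact/Clinear_average/Clinear_total.
- by exists m; apply/diffop_lt_average/diffop_lt_sum.
move=> _ [f qf <-]; set D := average rW (total h).
have iD w y : ratact rW w (D y) = D (ratact rW w y).
  have := congr1 (fun f => f (ratact rW w y)) (average_conjop rW w (total h)).
  by rewrite conjopE ratactK.
have [_ _ _ Am] := @admissible_subalgebra _ _ _ rW alpha alpha_ker k.
have [_ _ _] := Am _ _ (admissible_cgrp alpha_ker k_invariant (@idem_W C W))
   (Am _ _ Ah (admissible_cgrp alpha_ker k_invariant (@idem_W C W))).
have qf' : vector_quasi_invariant rW alpha k (fun v => polact rW v f).
  exact/(quasi_invariantP alpha_ker k_invariant).
move=> /(_ _ qf')[G qG GE].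
have GD v : (G v)%:F = D (polact rW v f)%:F.
  rewrite -GE /cact -[RHS]wt_sum mulr_sumr; apply: eq_bigr => w _.
  have E : ratact rW w (polact rW (w^-1 * v) f)%:F = (polact rW v f)%:F.
    by rewrite ratact_tofrac -(polactM rW w) mulKVg.
  by apply: etrans (sphericalE w _ lh) _; rewrite E.
exists (G 1%g); last by rewrite GD polact1.
apply/(quasi_invariantP alpha_ker k_invariant).
suff -> : (fun v => polact rW v (G 1%g)) = G by [].
apply: funext => v; apply/eqP; rewrite -tofrac_eq GD -ratact_tofrac GD polact1.
by rewrite -ratact_tofrac iD.
Qed.

Lemma cherednik_add a b : cherednik a -> cherednik b -> cherednik (a + b).
Proof. by have [_ Ha _ _] := @cherednik_subalgebra _ _ _ rW alpha k; apply: Ha. Qed.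

Lemma cherednik_cmul a b : cherednik a -> cherednik b -> cherednik (cmul rW a b).
Proof. by have [_ _ _ Hm] := @cherednik_subalgebra _ _ _ rW alpha k; apply: Hm. Qed.

Lemma cherednik_zero : cherednik (fun _ _ => 0).
Proof.
have [H1 _ Hc _] := @cherednik_subalgebra _ _ _ rW alpha k.
suff <- : cscale 0 (cop id) = (fun (_ : W) (_ : KV) => 0) by exact: Hc.
by apply: funext => w; apply: funext => x; rewrite /cscale rmorph0 mul0r.
Qed.

Lemma cherednik_one : cherednik (cop id).
Proof. by have [] := @cherednik_subalgebra _ _ _ rW alpha k. Qed.

Lemma cherednik_mul (p : CV) : cherednik (cop (mulop p%:F)).
Proof. by move=> S _; apply; left; left; exists p. Qed.

Lemma cherednik_dunkl xi : cherednik (dunkl xi).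
Proof. by move=> S _; apply; right; exists xi. Qed.

(** A Dunkl operator differs from the derivative by terms of order zero, so a product of them
    differs from [derivs m] by coefficients of order below [mdeg m], at every w. *)
Lemma cherednik_derivs m : exists2 h, cherednik h &
  forall w, diffop_lt (mdeg m) (fun x => h w x - cop (derivs m) w x).
Proof.
elim/multinom_ind: m => [|m i [h Hh hE]].
  exists (cop id); first exact: cherednik_one.
  move=> w; rewrite mdeg0 => x; rewrite !copE; case: (w == 1%g).
    by rewrite derivs0 subrr.
  by rewrite subrr.
have lh := let: And4 lh _ _ _ :=
  cherednik_admissible rW_faithful alpha_ker k_invariant Hh in lh.
exists (cmul rW (dunkl (delta_mx i ord0)) h).
  exact: (cherednik_cmul (cherednik_dunkl _) Hh).
have oh w : diffop_lt (mdeg m).+1 (h w).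
  apply: (@eq_diffop_lt _ _ _ (fun x => (h w x - cop (derivs m) w x) + cop (derivs m) w x)).
    by move=> x; rewrite subrK.
  apply: diffop_lt_add; first exact/diffop_ltS/hE.
  by rewrite /cop; case: (w == 1%g); [exact: diffop_lt_derivs | exact: diffop_lt_zero].
move=> w; rewrite mdegD mdeg1 addn1.
(* The error of [h] is differentiated, which raises its order by at most one; the order zero part is
   applied to [h], of order at most [mdeg m]. *)
apply: (@eq_diffop_lt _ _ _ (fun x => pderiv i (h w x - cop (derivs m) w x) +
   \sum_(u : W) - dunkl_coef rW alpha k (delta_mx i ord0) u *
     conjop rW u (h (u^-1 * w)%g) x)).
  move=> x; rewrite cmulE; under [X in _ = X - _]eq_bigr => u _ do rewrite dunklE -mulNr.
  rewrite big_split /= addrAC; congr (_ + _).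
  rewrite (bigD1 1%g) //= eqxx conjop1 invg1 mul1g big1 ?addr0 => [|u /negbTE -> //].
  rewrite -pderivE pderivB; congr (_ - _); rewrite !copE.
  case: (w == 1%g); first by rewrite derivsU.
  exact: (Clinear0 (Clinear_pderiv i)).
apply: diffop_lt_add.
  exact: (diffop_lt_comp (Clinear_pderiv i) (diffop_lt_pderiv i) (hE w)).
by apply: diffop_lt_sum => u; apply/diffop_lt_mull/diffop_lt_conjop/oh.
Qed.

(** Each monomial of degree m becomes its polynomial coefficient times a product of Dunkl operators;
    lower monomials are matched by 0. *)
Lemma cherednik_symbol m (p : {mpoly KV[n]}) : (msize p <= m.+1)%N ->
  (forall l, mdeg l = m -> exists g : CV, p@_l = g%:F) ->
  exists2 h, cherednik h & diffop_lt m (fun x => total h x - Op p x).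
Proof.
move=> sp pg.
have [h hP] : exists h : 'X_{1..n < m.+1} -> crossed, forall l : 'X_{1..n < m.+1},
    cherednik (h l) /\ diffop_lt m (fun x => total (h l) x - p@_l * derivs l x).
  apply: (@fin_all_exists _ (fun=> crossed) (fun (l : 'X_{1..n < m.+1}) h =>
    cherednik h /\ diffop_lt m (fun x => total h x - p@_l * derivs l x))) => l.
  have [lm|lm] := eqVneq (mdeg l) m; last first.
    exists (fun _ _ => 0); split; first exact: cherednik_zero.
    apply: (@eq_diffop_lt _ _ _ (fun x => - (p@_l * derivs l x))).
      by move=> x; rewrite /total big1 // sub0r.
    apply/diffop_lt_opp/diffop_lt_mull/(diffop_lt_le _ (diffop_lt_derivs l)).
    by rewrite ltn_neqAle lm -ltnS bmdeg.
  have [g gE] := pg l lm; have [h Hh hE] := cherednik_derivs l.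
  exists (cmul rW (cop (mulop g%:F)) h).
  split; first exact: (cherednik_cmul (cherednik_mul _) Hh).
  apply: (@eq_diffop_lt _ _ _ (fun x => g%:F *
     \sum_(w : W) (h w x - cop (derivs l) w x))); last first.
    by apply/diffop_lt_mull/diffop_lt_sum => w; move: (hE w); rewrite lm.
  move=> x; rewrite sumrB mulrBr; congr (_ - _).
    rewrite /total mulr_sumr; apply: eq_bigr => w _.
    by rewrite cmul_copE // /mulop mulr0.
  rewrite gE; congr (_ * _); rewrite (bigD1 1%g) //= copE eqxx.
  by rewrite big1 ?addr0 // => w /negbTE w1; rewrite copE w1.
exists (fun w x => \sum_(l : 'X_{1..n < m.+1}) h l w x).
  elim: (index_enum _) => [|l s IH].
    rewrite (_ : (fun _ => _) = (fun _ _ => 0)); first exact: cherednik_zero.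
    by apply: funext => w; apply: funext => x; rewrite big_nil.
  rewrite (_ : (fun _ => _) = h l + (fun w x => \sum_(l <- s) h l w x)).
    by apply: cherednik_add => //; case: (hP l).
  by apply: funext => w; apply: funext => x; rewrite big_cons.
apply: (@eq_diffop_lt _ _ _ (fun x => \sum_(l : 'X_{1..n < m.+1})
   (total (h l) x - p@_l * derivs l x))).
  by move=> x; rewrite sumrB (OpwE _ sp) /total exchange_big.
by apply: diffop_lt_sum => l; case: (hP l).
Qed.

Lemma invops_DQ_polynomial_symbol m D (p : {mpoly KV[n]}) :
  DQ rW alpha k D -> D =1 Op p -> (msize p <= m.+1)%N ->
  forall l, mdeg l = m -> exists g : CV, p@_l = g%:F.
Proof.
move=> [_ qD] DE sp.
(* The sum of all exponents n_H k_{H,i} bounds each of them. *)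
pose N := (\sum_(H <- hyperplanes rW) \sum_(i < hord rW H) hord rW H * k H i)%N.
have HN H : H \in hyperplanes rW -> forall i, (i < hord rW H)%N ->
    (hord rW H * k H i <= N)%N.
  move=> HH i iH; rewrite /N (bigD1_seq H) ?undup_uniq //=.
  by rewrite (bigD1 (Ordinal iH)) //= -addnA leq_addr.
have uHs : {in hyperplanes rW &, forall H H', H != H' ->
    ~ divides (lform H) (lform H')}.
  by move=> H H' HH HH' HnH'; apply: (linform_alpha_Ndivides alpha_ker).
apply: (@polynomial_symbol _ _ [seq lform H | H <- hyperplanes rW] N) => //.
- rewrite map_inj_in_uniq ?undup_uniq // => H H' HH HH' E.
  apply: contrapT => /eqP /(uHs _ _ HH HH'); apply.
  by rewrite E; apply: dividesxx.
- move=> _ /mapP[H HH ->]; apply: linform_prime_mpoly.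
  exact: (alpha_neq0 alpha_ker).
- move=> _ _ /mapP[H HH ->] /mapP[H' HH' ->] E; apply: uHs => //.
  by apply: contraNneq E => ->.
move=> r f; rewrite big_map.
have := quasi_invariant_alpha alpha_ker f HN; move: (_ * f) => g qg.
suff [g' _ <-] : [set f%:F | f in QI] (iter r (Op p) g%:F) by exists g'.
elim: r => [|r IH]; first by exists g.
by rewrite iterS -DE; apply: qD.
Qed.

(* The top-order part of D is matched by an element of e H_k e; the difference
   is again in D(Q_k)^W and has smaller order. *)
Lemma invops_DQ_average D : invops rW (DQ rW alpha k) D ->
  exists2 h, cherednik h & D = average rW (total h).
Proof.
move=> iD; have [[[_ [m oD]] _] _] := iD.
elim: m D oD iD => [|m IH] D oD iD.
  exists (fun _ _ => 0); first exact: cherednik_zero.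
  apply: funext => x; rewrite oD /average big1 ?mulr0 // => w _.
  by rewrite conjopE /total big1 // raddf0.
have [dD cD] := iD; have [[lD _] qD] := dD.
have [p sp pE] := diffop_lt_symbol lD oD.
have [h Hh hE] := cherednik_symbol sp (invops_DQ_polynomial_symbol dD pE sp).
have Ah := cherednik_admissible rW_faithful alpha_ker k_invariant Hh.
have [[[lh oh] qh] ch] := admissible_average_DQ Ah.
pose D' x := D x - average rW (total h) x.
(* D is its own average, so D' is the average of [Op p] minus [total h], and averaging does not
   raise the order. *)
have oD' : diffop_lt m D'.
  apply: (@eq_diffop_lt _ _ _ (average rW (fun x => - (total h x - Op p x)))).
    move=> x; rewrite /D' -[in RHS](average_id cD) -average_sub.
    congr (average rW _ x); apply: funext => y.
    by rewrite -pE opprB.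
  exact/diffop_lt_average/diffop_lt_opp/hE.
have [|h' Hh' h'E] := IH D' oD'.
  split; last first.
    move=> w; apply: funext => x; rewrite /D' conjopE ratact_sub.
    by rewrite -!conjopE cD ch.
  split; first split.
  - exact: Clinear_add lD (Clinear_opp lh).
  - by exists m.
  move=> x Qx; have [f qf fE] := qD x Qx; have [g qg gE] := qh x Qx.
  exists (f - g); last by rewrite /D' -fE -gE tofracB.
  move=> H HH i iH; have [f' f'E] := qf H HH i iH; have [g' g'E] := qg H HH i iH.
  exists (f' - g'); rewrite mulrBl -f'E -g'E /Defs.gact -sumrB.
  by apply: eq_bigr => w _; rewrite polact_sub scalerBr.
exists (h + h'); first exact: cherednik_add.
have totalD x : total (h + h') x = total h x + total h' x.
  by rewrite /total -big_split.
apply: funext => x; have := congr1 (fun f => f x) h'E; rewrite /D'.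
move=> /eqP; rewrite subr_eq => /eqP ->; rewrite addrC /average -mulrDr -big_split.
by congr (_ * _); apply: eq_bigr => w _; rewrite !conjopE /= totalD ratact_add.
Qed.

Lemma sphericalP (u : crossed) : spherical rW alpha k u ->
  exists h, [/\ cherednik h, (forall w x, u w x = wt * average rW (total h) x)
    & Res rW alpha u = average rW (total h)].
Proof.
move=> [h Hh <-]; exists h.
have Ah := cherednik_admissible rW_faithful alpha_ker k_invariant Hh.
have lh := let: And4 lh _ _ _ := Ah in lh.
have uE w x := @sphericalE h w x lh.
by split=> //; apply: Res_eq uE; apply: admissible_average_DVreg.
Qed.

Lemma Res_image : [set Res rW alpha u | u in spherical rW alpha k]
  = invops rW (DQ rW alpha k).
Proof.
apply/seteqP; split=> [_ [u /sphericalP[h [Hh _ ->]] <-]|D iD].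
  by apply/admissible_average_DQ/cherednik_admissible.
have [h Hh DE] := invops_DQ_average iD.
exists (cmul rW idW (cmul rW h idW)); first by exists h.
have [|h' [_ uE' ->]] := @sphericalP (cmul rW idW (cmul rW h idW)); first by exists h.
have lh := let: And4 lh _ _ _ :=
  cherednik_admissible rW_faithful alpha_ker k_invariant Hh in lh.
rewrite DE; apply: funext => x; apply: (mulfI wt_neq0).
by rewrite -(uE' 1%g) sphericalE.
Qed.

Lemma Res_iso : algebra_iso rW idW (spherical rW alpha k)
  (invops rW (DQ rW alpha k)) (Res rW alpha).
Proof.
have DV u : spherical rW alpha k u -> invops rW (DVreg rW alpha) (Res rW alpha u).
  move=> /sphericalP[h [Hh _ ->]].
  by apply/admissible_average_DVreg/cherednik_admissible.
have ResE u w x : spherical rW alpha k u -> u w x = wt * Res rW alpha u x.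
  by move=> /sphericalP[h [_ -> ->]].
split.
- split.
  + by move=> u Su; rewrite -Res_image; exists u.
  (* Every coefficient of u is recovered from its image under [Res]. *)
  + move=> u v /set_mem Su /set_mem Sv E; apply: funext => w; apply: funext => x.
    by rewrite !ResE // E.
  + by move=> D; rewrite -{1}Res_image.
- apply: Res_eq => //; split; last first.
    by move=> w; apply: funext => x; rewrite conjopE ratactKV.
  split=> //; split; first exact: Clinear_id.
  exists 1%N; apply: eq_diffop_lt (@diffop_lt_mulop C n 1) => x.
  by rewrite /mulop mul1r.
- move=> a b Sa Sb; have [[[la [ma oa]] Va] ia] := DV a Sa.
  have [[[lb [mb ob]] Vb] ib] := DV b Sb.
  apply: Res_eq => [|w x]; last by rewrite mulrDr -(ResE a w x Sa) -(ResE b w x Sb).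
  split; last first.
    move=> w; apply: funext => x; rewrite conjopE /= ratact_add -!conjopE.
    by rewrite ia ib.
  split; last by move=> x Vx; apply: (Vreg_add alpha_ker); [apply: Va | apply: Vb].
  split; first exact: Clinear_add la lb.
  exists (maxn ma mb); apply: diffop_lt_add.
    by apply: diffop_lt_le oa; rewrite leq_maxl.
  by apply: diffop_lt_le ob; rewrite leq_maxr.
- move=> c a Sa; have [[[la [ma oa]] Va] ia] := DV a Sa.
  apply: Res_eq => [|w x]; last by rewrite /cscale mulrCA -(ResE a w x Sa).
  split; last first.
    by move=> w; apply: funext => x; rewrite conjopE ratact_mul ratact_const -conjopE ia.
  split; last by move=> x Vx; apply: (Vreg_mul (Vreg_const _ _ _)); apply: Va.
  split; first exact: (Clinear_comp (Clinear_mulop (constK n c)) la).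
  by exists ma; apply: diffop_lt_mull.
- move=> a b Sa Sb; have [[[la [ma oa]] Va] ia] := DV a Sa.
  have [[[lb [mb ob]] Vb] ib] := DV b Sb.
  apply: Res_eq => [|w x].
    split; last first.
      move=> w; apply: funext => x; rewrite conjopE /=.
      rewrite -[in RHS](ia w) conjopE /=; congr (ratact rW w (Res rW alpha a _)).
      by rewrite -[in RHS](ib w) conjopE /= ratactK.
    split; last by move=> x Vx; apply/Va/Vb.
    split; first exact: Clinear_comp la lb.
    by exists (ma + mb).-1; apply: diffop_lt_comp.
  (* By invariance of the second factor, the |W| terms of the product are equal, each with factor
     |W|^-2. *)
  rewrite cmulE -[(Res rW alpha a \o _) x]wt_sum !mulr_sumr; apply: eq_bigr => u _.
  rewrite (ResE a u _ Sa) conjopE (ResE b _ _ Sb) ratact_mul ratact_const -conjopE ib.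
  by rewrite (ClinearZ la).
Qed.

End SphericalSubalgebra.

Local Open Scope complex_scope.

Theorem proposition4p3 (R : realType) (n : nat) (W : finGroupType)
    (rW : mx_representation R[i] [set: W]%G n)
    (rW_faithful : mx_faithful rW)
    (rW_reflections : <<[set w | is_reflection rW w]%SET>>%g = [set: W]%SET)
    (alpha : {vspace 'cV[R[i]]_n} -> 'Hom('cV[R[i]]_n, (R[i])^o))
    (alpha_ker : forall H, H \in hyperplanes rW -> lker (alpha H) = H)
    (k : {vspace 'cV[R[i]]_n} -> nat -> nat)
    (k_invariant : forall (w : W) H, H \in hyperplanes rW ->
       forall i, (i < hord rW H)%N -> k (lact rW w @: H)%VS i = k H i)
    (k_zero : forall H, H \in hyperplanes rW -> k H 0%N = 0%N) :
  [set Res rW alpha u | u in spherical rW alpha k]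
    = invops rW (DQ rW alpha k)
  /\ algebra_iso rW (cgrp (@idem_W R[i] W)) (spherical rW alpha k)
       (invops rW (DQ rW alpha k)) (Res rW alpha).
Proof.
split.
- exact: (Res_image rW_faithful alpha_ker k_invariant).
- exact: (Res_iso rW_faithful alpha_ker k_invariant).
Qed.
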